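(* Let $T>0$, let $(b,\sigma,f,g)$ satisfy the standing Lipschitz/integrability assumption (A) of the context and let $x\in\mathbb{R}^d$. Assume that there exists a decoupling field $u$ for the FBSDE $$dX_t=b_t(X,Y_t,Z_t)\,dt+\sigma_t(X,Y_t,Z_t)\,dW_t,\quad X_0=x,\qquad dY_t=-f_t(X,Y_t,Z_t)\,dt+Z_t\,dW_t,\quad Y_T=g(X).$$ Then this FBSDE has a unique solution $(X,Y,Z)$ on $[0,T]$, and $Y_t=u_t(X)$ for all $t\in[0,T]$.
   Context: Setting. $(\Omega,\mathcal F,\mathbb P)$ is a probability space carrying an $n$-dimensional Brownian motion $W$, and $\mathbb F=(\mathcal F_t)_{t\ge0}$ is the $\mathbb P$-augmented natural filtration of $W$. $T>0$, $d,n\ge1$. For $\mathrm x\in\mathcal C([0,T],\mathbb R^d)$ (continuous paths) and $t\in[0,T]$ put $\|\mathrm x\|_{2,t}^2:=\int_0^t|\mathrm x(s)|^2ds+|\mathrm x(t)|^2$. $\mathcal M_{d,n}$ is the space of real $d\times n$ matrices, $\mathcal M_n=\mathcal M_{n,n}$, with Euclidean norm. $\Theta:=\mathcal C([0,T],\mathbb R^d)\times\mathbb R^n\times\mathcal M_n$. The coefficients are $(b,\sigma,f):[0,T]\times\Omega\times\Theta\to\mathbb R^d\times\mathcal M_{d,n}\times\mathbb R^n$ and $g:\Omega\times\mathcal C([0,T],\mathbb R^d)\to\mathbb R^n$; the argument $\omega$ is usually omitted. Assumption (A). (i) For $\xi=b,\sigma,f$ and fixed $\theta\in\Theta$, $\xi_\cdot(\theta)$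 is $\mathbb F$-progressively measurable, and there is $K_0>0$ such that $|\xi_t(\omega,\theta)-\xi_t(\omega,\theta')|\le K_0(\|\mathrm x-\mathrm x'\|_{2,t}+|y-y'|+|z-z'|)$ for all $t,\omega$ and $\theta=(\mathrm x,y,z),\theta'=(\mathrm x',y',z')\in\Theta$. (ii) $g$ is jointly measurable ($\mathcal F_T$-measurable in $\omega$) and there is $K_1>0$ with $|g(\omega,\mathrm x)-g(\omega,\mathrm x')|\le K_1\|\mathrm x-\mathrm x'\|_{2,T}$ for all $\omega,\mathrm x,\mathrm x'$. (iii) With $\xi^0:=\xi(\cdot,0)$, $\mathbb E\big[\big(\int_0^T(|b^0_t|+|f^0_t|)dt\big)^2+\int_0^T|\sigma^0_t|^2dt+|g^0|^2\big]<\infty$. Solutions. A solution on $[t_1,t_2]\subset[0,T]$ with initial condition $X_{\cdot\wedge t_1}=\mathrm x$ and given terminal condition for $Y_{t_2}$ is a triple of $\mathbb F$-adapted processes ($X,Y$ continuous, $X$ defined on $[0,t_2]$ and equal to $\mathrm x$ on $[0,t_1]$, $Z$ progressively measurable) satisfying the equations on $[t_1,t_2]$ and $\sup_{t\in[t_1,t_2]}\mathbb E\big[\|X\|_{2,t}^2+|Y_t|^2+\int_t^{t_2}|Z_s|^2ds\big]<\infty$. Uniqueness is in this class, up to indistinguishability (and $dt\otimes d\mathbb P$-a.e. for $Z$). $\mathbb H^2_{t}(\mathbb F,\mathbb R^d)$ denotes the continuous $\mathbb F$-adapted $\mathbb R^d$-valued processes $\mathrm x$ on $[0,t]$ with $\mathbb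 E\|\mathrm x\|_{2,t}^2<\infty$. Decoupling field. An $\mathbb F$-progressively measurable random field $u:[0,T]\times\Omega\times\mathcal C([0,T],\mathbb R^d)\to\mathbb R^n$ with $u(T,\omega,\mathrm x)=g(\omega,\mathrm x)$, depending on $\mathrm x$ at time $t$ only through $\mathrm x_{\cdot\wedge t}$, is a decoupling field of the FBSDE if there is $\delta>0$ such that for all $0\le t_1<t_2\le T$ with $t_2-t_1\le\delta$ and all $\mathrm x\in\mathbb H^2_{t_1}(\mathbb F,\mathbb R^d)$, the FBSDE on $[t_1,t_2]$ with initial condition $X_{\cdot\wedge t_1}=\mathrm x$ and terminal condition $Y_{t_2}=u(t_2,X)$ has a unique solution, and this solution satisfies $Y_t=u(t,\omega,X_{\cdot\wedge t})$ for $t\in[t_1,t_2]$, $\mathbb P$-a.s. Write $u_t(X):=u(t,\omega,X)$. *)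

(* Defs.v *)
From HB Require Import structures.
From mathcomp Require Import all_boot all_order all_algebra.
From mathcomp Require Import all_classical all_reals all_analysis.

Set Implicit Arguments.
Unset Strict Implicit.
Unset Printing Implicit Defensive.

Import Order.TTheory GRing.Theory Num.Theory.
Import numFieldNormedType.Exports.

Local Open Scope classical_set_scope.
Local Open Scope ring_scope.

(* Vectors of R^n are column vectors.  The library norm on matrices is the
   sup norm; the norms |.| of the theory are Euclidean (Frobenius). *)
Definition enorm (R : realType) (m n : nat) (A : 'M[R]_(m, n)) : R :=
  Num.sqrt (\sum_(i < m) \sum_(j < n) A i j ^+ 2).

(* C([0,T], R^d).  A path is represented by a total function whose values
   outside [0,T] are irrelevant: the Lipschitz condition on the coefficients,
   the non-anticipativity of decoupling fields and the sigma-algebra below only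
   see the values on [0,T]. *)
Record cpath (R : realType) (T : R) (d : nat) := CPath {
  cpath_fun :> R -> 'cV[R]_d;
  cpath_cont : {within `[0, T], continuous cpath_fun} }.

Lemma cst_cont (R : realType) (T : R) (d : nat) (c : 'cV[R]_d) :
  {within `[0, T], continuous (fun _ : R => c)}.
Proof. exact/continuous_subspaceT/cst_continuous. Qed.

Definition cst_path (R : realType) (T : R) (d : nat) (c : 'cV[R]_d)
  : cpath T d := CPath (@cst_cont R T d c).

HB.instance Definition _ (R : realType) (T : R) (d : nat) :=
  gen_eqMixin (cpath T d).
HB.instance Definition _ (R : realType) (T : R) (d : nat) :=
  gen_choiceMixin (cpath T d).
HB.instance Definition _ (R : realType) (T : R) (d : nat) :=
  isPointed.Build (cpath T d) (cst_path T 0).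

(* Coordinate cylinders; they generate the Borel sigma-algebra of
   C([0,T], R^d), both for the uniform norm and for pnorm T. *)
Definition cylinders (R : realType) (T : R) (d : nat) : set (set (cpath T d)) :=
  [set A | exists (s : R) (i : 'I_d) (B : set (measurableTypeR R)),
     [/\ 0 <= s <= T, measurable B & A = [set x : cpath T d | B (x s i 0)]]].

Definition borel_cpath (R : realType) (T : R) (d : nat) :=
  g_sigma_algebraType (@cylinders R T d).

(* ||x||_{2,t} *)
Definition pnorm (R : realType) (d : nat) (t : R) (x : R -> 'cV[R]_d) : R :=
  Num.sqrt ((\int[lebesgue_measure]_(s in `[0, t]) (enorm (x s) ^+ 2))
            + enorm (x t) ^+ 2).

Section probability_space.
Context {R : realType} {disp : measure_display} {Om : measurableType disp}.
Variable P : probability Om R.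

(* Events generated by the coordinates of W up to time s. *)
Definition past_events (n : nat) (W : R -> Om -> 'cV[R]_n) (s : R)
  : set (set Om) :=
  [set A | exists (r : R) (i : 'I_n) (B : set (measurableTypeR R)),
     [/\ 0 <= r <= s, measurable B & A = [set w | B (W r w i 0)]]].

(* bm_incr: W_t - W_s is independent of sigma(W_r, r <= s), with law
   N(0, (t - s) I_n); normal_prob takes the standard deviation. *)
Record brownian_motion (n : nat) (W : R -> Om -> 'cV[R]_n) : Prop := {
  bm_meas : forall (t : R) (i : 'I_n), 0 <= t ->
    measurable_fun [set: Om] (fun w => W t w i 0 : measurableTypeR R);
  bm_start : {ae P, forall w, W 0 w = 0};
  bm_cont : {ae P, forall w, {within `[0, +oo[, continuous (W ^~ w)}};
  bm_incr : forall (s t : R) (A : set Om) (B : 'I_n -> set (measurableTypeR R)),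
    0 <= s -> s < t -> <<s past_events W s >> A ->
    (forall i, measurable (B i)) ->
    P (A `&` [set w | forall i, B i (W t w i 0 - W s w i 0)])
    = (P A * (\prod_(i < n) fine (normal_prob 0 (Num.sqrt (t - s)) (B i)))%:E)%E
}.

(* Augmented natural filtration.  The null sets added are the measurable ones:
   when P is complete these are all the negligible sets, and in general F_t
   stays inside the sigma-algebra on which P is defined. *)
Definition aug_filtration (n : nat) (W : R -> Om -> 'cV[R]_n) (t : R)
  : set (set Om) :=
  <<s past_events W t `|` [set N | measurable N /\ P N = 0%E] >>.

Definition measurable_wrt (G : set (set Om)) (m n : nat)
  (f : Om -> 'M[R]_(m, n)) : Prop :=
  forall i j, measurable_fun [set: g_sigma_algebraType G]
    (fun w : g_sigma_algebraType G => f w i j : measurableTypeR R).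

Definition adapted (F : R -> set (set Om)) (t1 t2 : R) (m n : nat)
  (H : R -> Om -> 'M[R]_(m, n)) : Prop :=
  forall t, t1 <= t <= t2 -> measurable_wrt (F t) (H t).

(* For every t in [t1,t2], the restriction of H to [t1,t] x Omega is
   B([t1,t]) (x) F_t-measurable. *)
Definition progressive (F : R -> set (set Om)) (t1 t2 : R) (m n : nat)
  (H : R -> Om -> 'M[R]_(m, n)) : Prop :=
  forall t, t1 <= t <= t2 -> forall i j,
    measurable_fun (`[t1, t] `*` [set: g_sigma_algebraType (F t)])
      (fun p : measurableTypeR R * g_sigma_algebraType (F t) =>
         H p.1 p.2 i j : measurableTypeR R).

(* E int_{t1}^{t2} |H_s|^2 ds *)
Definition sqnorm_L2 (t1 t2 : R) (m n : nat) (H : R -> Om -> 'M[R]_(m, n))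
  : \bar R :=
  (\int[P]_w \int[lebesgue_measure]_(s in `[t1, t2]) (enorm (H s w) ^+ 2)%:E)%E.

(* The simple integrand sum_k xi_k 1_{(a_k, b_k]}; the intervals may overlap,
   which gives the same class as ordered partitions. *)
Record simple_process (m n : nat) := SimpleProcess {
  sp_size : nat;
  sp_a : 'I_sp_size -> R;
  sp_b : 'I_sp_size -> R;
  sp_xi : 'I_sp_size -> Om -> 'M[R]_(m, n) }.

Definition simple_on (F : R -> set (set Om)) (t1 t2 : R) (m n : nat)
  (S : simple_process m n) : Prop :=
  forall k : 'I_(sp_size S),
    [/\ t1 <= sp_a k, sp_a k <= sp_b k, sp_b k <= t2,
        measurable_wrt (F (sp_a k)) (sp_xi k)
      & exists C : R, forall w, enorm (sp_xi k w) <= C].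

Definition simple_val (m n : nat) (S : simple_process m n) (t : R) (w : Om)
  : 'M[R]_(m, n) :=
  \sum_(k < sp_size S | sp_a k < t <= sp_b k) sp_xi k w.

Definition simple_int (n : nat) (W : R -> Om -> 'cV[R]_n) (m : nat)
  (S : simple_process m n) (t : R) (w : Om) : 'cV[R]_m :=
  \sum_(k < sp_size S)
    sp_xi k w *m (W (Num.min (sp_b k) t) w - W (Num.min (sp_a k) t) w).

(* M_t = int_{t1}^t H_s dW_s for t in [t1,t2]: H is progressive and square
   integrable and M is the (a.s.) continuous L^2-limit of the integrals of
   simple processes approximating H.  This determines M up to
   indistinguishability. *)
Definition ito_integral (n : nat) (W : R -> Om -> 'cV[R]_n) (t1 t2 : R)
  (m : nat) (H : R -> Om -> 'M[R]_(m, n)) (M : R -> Om -> 'cV[R]_m) : Prop :=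
  let F := aug_filtration W in
  [/\ progressive F t1 t2 H,
      (sqnorm_L2 t1 t2 H < +oo)%E,
      adapted F t1 t2 M,
      {ae P, forall w, {within `[t1, t2], continuous (M ^~ w)}}
    & exists S : nat -> simple_process m n,
      [/\ forall k, simple_on F t1 t2 (S k),
          (fun k => sqnorm_L2 t1 t2 (fun s w => H s w - simple_val (S k) s w))
            @ \oo --> 0%E
        & forall t, t1 <= t <= t2 ->
          (fun k => \int[P]_w (enorm (M t w - simple_int W (S k) t w) ^+ 2)%:E)%E
            @ \oo --> 0%E]].

(* dV_t = beta_t dt + H_t dW_t on [t1,t2], in integrated form; both integrals
   are required to make sense. *)
Definition ito_equation (n : nat) (W : R -> Om -> 'cV[R]_n) (t1 t2 : R)
  (m : nat) (V : R -> Om -> 'cV[R]_m)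
  (beta : R -> Om -> 'cV[R]_m) (H : R -> Om -> 'M[R]_(m, n)) : Prop :=
  {ae P, forall w, forall i,
     lebesgue_measure.-integrable `[t1, t2] (fun s => (beta s w i 0)%:E)} /\
  exists2 M : R -> Om -> 'cV[R]_m,
    ito_integral W t1 t2 H M
    & {ae P, forall w, forall t : R, t1 <= t <= t2 ->
       V t w = V t1 w
         + (\col_i \int[lebesgue_measure]_(s in `[t1, t]) beta s w i 0)
         + M t w}.

Section fbsde.
Variables (d n : nat) (W : R -> Om -> 'cV[R]_n) (T : R).

Local Notation C := (cpath T d).
Local Notation F := (aug_filtration W).
Variables (b : R -> Om -> C -> 'cV[R]_n -> 'M[R]_n -> 'cV[R]_d)
          (sigma : R -> Om -> C -> 'cV[R]_n -> 'M[R]_n -> 'M[R]_(d, n))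
          (f : R -> Om -> C -> 'cV[R]_n -> 'M[R]_n -> 'cV[R]_n)
          (g : Om -> C -> 'cV[R]_n).

Definition lipschitz_coef (K : R) (p q : nat)
  (xi : R -> Om -> C -> 'cV[R]_n -> 'M[R]_n -> 'M[R]_(p, q)) : Prop :=
  forall (t : R) w (x x' : C) y y' z z', 0 <= t <= T ->
    enorm (xi t w x y z - xi t w x' y' z')
    <= K * (pnorm t (fun s => x s - x' s) + enorm (y - y') + enorm (z - z')).

Record assumption_A : Prop := {
  A_prog : forall (x : C) y z,
    [/\ progressive F 0 T (fun t w => b t w x y z),
        progressive F 0 T (fun t w => sigma t w x y z)
      & progressive F 0 T (fun t w => f t w x y z)];
  A_lip : exists2 K0 : R, 0 < K0 &
    [/\ lipschitz_coef K0 b, lipschitz_coef K0 sigma & lipschitz_coef K0 f];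
  A_g_meas : forall i,
    measurable_fun [set: g_sigma_algebraType (F T) * borel_cpath T d]
      (fun p : g_sigma_algebraType (F T) * borel_cpath T d =>
         g p.1 p.2 i 0 : measurableTypeR R);
  A_g_lip : exists2 K1 : R, 0 < K1 & forall w (x x' : C),
    enorm (g w x - g w x') <= K1 * pnorm T (fun s => x s - x' s);
  A_int : let x0 := cst_path T 0 in
    (\int[P]_w
       ((\int[lebesgue_measure]_(t in `[0%R, T])
           (enorm (b t w x0 0 0) + enorm (f t w x0 0 0))%R%:E) ^+ 2
        + \int[lebesgue_measure]_(t in `[0%R, T])
            (enorm (sigma t w x0 0 0) ^+ 2)%R%:E
        + (enorm (g w x0) ^+ 2)%R%:E) < +oo)%E }.

(* Continuous adapted processes on [0,t] are represented by random elements of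
   C([0,T], R^d) whose values after t are irrelevant. *)
Definition H2 (t : R) (x : Om -> C) : Prop :=
  adapted F 0 t (fun s w => x w s) /\
  (\int[P]_w (pnorm t (x w) ^+ 2)%:E < +oo)%E.

(* Solution on [t1,t2] with X = x on [0,t1] and Y_{t2} = h(X).  X is only
   meaningful on [0,t2], Y and Z on [t1,t2]. *)
Record fbsde_solution (t1 t2 : R) (x : Om -> C) (h : Om -> C -> 'cV[R]_n)
  (X : Om -> C) (Y : R -> Om -> 'cV[R]_n) (Z : R -> Om -> 'M[R]_n) : Prop := {
  sol_X_adapted : adapted F 0 t2 (fun t w => X w t);
  sol_Y_adapted : adapted F t1 t2 Y;
  sol_Y_cont : forall w, {within `[t1, t2], continuous (Y ^~ w)};
  sol_Z_prog : progressive F t1 t2 Z;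
  sol_init : {ae P, forall w, forall t : R, 0 <= t <= t1 -> X w t = x w t};
  sol_forward : ito_equation W t1 t2 (fun t w => X w t)
    (fun t w => b t w (X w) (Y t w) (Z t w))
    (fun t w => sigma t w (X w) (Y t w) (Z t w));
  sol_backward : ito_equation W t1 t2 Y
    (fun t w => - f t w (X w) (Y t w) (Z t w)) Z;
  sol_terminal : {ae P, forall w, Y t2 w = h w (X w)};
  sol_bound :
    (ereal_sup [set \int[P]_w
       ((pnorm t (X w) ^+ 2 + enorm (Y t w) ^+ 2)%:E
        + \int[lebesgue_measure]_(s in `[t, t2]) (enorm (Z s w) ^+ 2)%:E)
     | t in `[t1, t2]] < +oo)%E }.

Definition same_solution (t1 t2 : R)
  (X : Om -> C) (Y : R -> Om -> 'cV[R]_n) (Z : R -> Om -> 'M[R]_n)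
  (X' : Om -> C) (Y' : R -> Om -> 'cV[R]_n) (Z' : R -> Om -> 'M[R]_n) : Prop :=
  [/\ {ae P, forall w, forall t : R, 0 <= t <= t2 -> X w t = X' w t},
      {ae P, forall w, forall t : R, t1 <= t <= t2 -> Y t w = Y' t w}
    & {ae (lebesgue_measure \x P)%E, forall p : measurableTypeR R * Om,
        t1 <= p.1 <= t2 -> Z p.1 p.2 = Z' p.1 p.2}].

Definition unique_solution (t1 t2 : R) (x : Om -> C)
  (h : Om -> C -> 'cV[R]_n) : Prop :=
  (exists X Y Z, fbsde_solution t1 t2 x h X Y Z) /\
  (forall X Y Z X' Y' Z',
     fbsde_solution t1 t2 x h X Y Z -> fbsde_solution t1 t2 x h X' Y' Z' ->
     same_solution t1 t2 X Y Z X' Y' Z').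

(* P-a.s., Y_t = u(t, X) for all t in [t1,t2]. *)
Definition decoupled (u : R -> Om -> C -> 'cV[R]_n) (t1 t2 : R)
  (X : Om -> C) (Y : R -> Om -> 'cV[R]_n) : Prop :=
  {ae P, forall w, forall t : R, t1 <= t <= t2 -> Y t w = u t w (X w)}.

Record decoupling_field (u : R -> Om -> C -> 'cV[R]_n) : Prop := {
  df_prog : forall t : R, 0 <= t <= T -> forall i,
    measurable_fun
      (`[0, t] `*` [set: g_sigma_algebraType (F t)] `*` [set: borel_cpath T d])
      (fun p : measurableTypeR R * g_sigma_algebraType (F t) * borel_cpath T d =>
         u p.1.1 p.1.2 p.2 i 0 : measurableTypeR R);
  df_terminal : forall w x, u T w x = g w x;
  df_nonanticipative : forall (t : R) w (x x' : C), 0 <= t <= T ->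
    (forall s : R, 0 <= s <= t -> x s = x' s) -> u t w x = u t w x';
  df_local : exists2 delta : R, 0 < delta &
    forall t1 t2 : R, 0 <= t1 -> t1 < t2 -> t2 <= T -> t2 - t1 <= delta ->
    forall x : Om -> C, H2 t1 x ->
      unique_solution t1 t2 x (u t2) /\
      (forall X Y Z, fbsde_solution t1 t2 x (u t2) X Y Z ->
         decoupled u t1 t2 X Y) }.

End fbsde.
End probability_space.

(* Main.v *)
Require Import Defs.
From mathcomp Require Import all_boot all_order all_algebra.
From mathcomp Require Import all_classical all_reals all_analysis.
From mathcomp Require Import measurable_realfun.
From mathcomp Require Import lra.
Import Order.TTheory GRing.Theory Num.Theory.
Import numFieldNormedType.Exports.
Local Open Scope classical_set_scope.
Local Open Scope ring_scope.

(** A decoupling field turns the global problem into a chain of local ones. Say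
    that an interval [t1,t2] is decoupled if, for every initial path in H^2, the
    FBSDE on it with terminal value u_{t2}(X) is uniquely solvable and its
    solution satisfies Y = u(X). Short intervals are decoupled by assumption, and
    the whole proof is the lemma [decoupled_on_glue]: if [t1,s] and [s,t2] are
    decoupled then so is [t1,t2]. Doubling the length finitely many times reaches
    [0,T], where u_T = g.

    Gluing runs in two directions. Backwards in time, a solution on [t1,t2]
    restricts to [s,t2], where decoupling gives Y_s = u_s(X); with this terminal
    condition its restriction to [t1,s] solves the local problem, hence Y = u(X)
    everywhere. Forwards in time, two solutions agree on [t1,s], so that they start
    from the same path on [s,t2] and agree there too; and for existence the local
    solution on [t1,s] is continued by the one on [s,t2], the two values of Y_s
    being both equal to u_s(X).

    The work lies in checking that solutions can be restricted ([solutionS]) and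
    concatenated ([solution_paste]), in particular their stochastic integrals,
    which are L^2-limits of integrals of simple processes: restriction clips the
    simple processes to the smaller interval, concatenation puts them side by side
    ([ito_integralS], [ito_integral_paste]). Two difficulties are of a
    measure-theoretic kind. Pieces match only almost surely, whereas continuity of
    Y and progressive measurability of sigma(X,Y,Z) are required for every outcome;
    the concatenation is therefore reset to zero on the exceptional null event,
    which belongs to every F_t. And the moment bounds concern functions that need
    not be known to be measurable; they are compared through the monotonicity and
    partial subadditivity of the integral of arbitrary nonnegative functions
    ([ge0_le_integralD_ae]). *)

Set Implicit Arguments.
Unset Strict Implicit.
Unset Printing Implicit Defensive.

(** * Integrals of nonnegative functions without measurability *)

Section nonneg_integral.
Context {R : realType} {disp : measure_display} {U : measurableType disp}.
Variable mu : {measure set U -> \bar R}.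
Local Open Scope ereal_scope.
Import HBNNSimple.

Lemma ge0_le_integralT (f g : U -> \bar R) :
  (forall x, 0 <= f x) -> (forall x, f x <= g x) ->
  \int[mu]_x f x <= \int[mu]_x g x.
Proof.
move=> f0 fg; have g0 x : 0 <= g x by exact: le_trans (f0 x) (fg x).
rewrite !ge0_integralTE//; apply: ge_ereal_sup => _ [h /= hf <-].
by apply: ereal_sup_ubound; exists h => //= x; exact: le_trans (hf x) (fg x).
Qed.

(** The integral of a nonnegative function is a supremum over the simple
    functions below it, hence superadditive; it stays subadditive as soon as
    one of the two summands is measurable, because subtracting that summand from
    a simple function leaves a measurable function. This avoids proving that
    [||X||_{2,t}] is a random variable. *)
Lemma ge0_le_integralDT (f g h : U -> \bar R) :
  (forall x, 0 <= f x) -> (forall x, 0 <= g x) -> (forall x, 0 <= h x) ->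
  measurable_fun setT h -> (forall x, f x <= g x + h x) ->
  \int[mu]_x f x <= \int[mu]_x g x + \int[mu]_x h x.
Proof.
move=> f0 g0 h0 mh fgh.
rewrite [X in X <= _]ge0_integralTE//; apply: ge_ereal_sup => _ [phi /= phif <-].
rewrite -integralT_nnsfun.
pose k x := maxe ((phi x)%:E - h x) 0.
have mk : measurable_fun setT k.
  apply: measurable_maxe => //; apply: emeasurable_funB => //.
  exact/measurable_EFinP.
have k0 x : 0 <= k x by rewrite /k le_max lexx orbT.
apply: (@le_trans _ _ (\int[mu]_x (k x + h x))).
  apply: ge0_le_integralT => x; first by rewrite lee_fin.
  rewrite /k; have := h0 x; case: (h x) => [r| |]// r0.
    by rewrite -leeBlDr// le_max lexx.
  by rewrite addey ?leey// gt_eqF// (@lt_le_trans _ _ 0)// le_max lexx orbT.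
rewrite ge0_integralD//; apply: leeD => //.
apply: ge0_le_integralT => // x; rewrite /k ge_max g0 andbT.
have := le_trans (phif x) (fgh x); have := h0 x.
case: (h x) => [r _|_ _|//]; last by rewrite leNye.
by move=> le1; rewrite leeBlDr.
Qed.

Lemma patch_ge0 (D : set U) (f : U -> \bar R) :
  (forall x, D x -> 0 <= f x) -> forall x, 0 <= (f \_ D) x.
Proof. by move=> f0 x; rewrite patchE; case: ifPn => // /set_mem/f0. Qed.

(** Form in which the two previous bounds are used: everything may fail on a null
    set, which is absorbed by the measurable function equal to infinity there. *)
Lemma ge0_le_integralD_ae (D D1 D2 N : set U) (f g h : U -> \bar R) :
  (forall x, D x -> 0 <= f x) -> (forall x, D1 x -> 0 <= g x) ->
  (forall x, D2 x -> 0 <= h x) ->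
  measurable D2 -> measurable_fun D2 h -> measurable N -> mu N = 0 ->
  (forall x, ~ N x -> (f \_ D) x <= (g \_ D1) x + (h \_ D2) x) ->
  \int[mu]_(x in D) f x <= \int[mu]_(x in D1) g x + \int[mu]_(x in D2) h x.
Proof.
move=> f0 g0 h0 mD2 mh mN N0 fgh.
pose e : U -> \bar R := (cst +oo) \_ N.
have e0 : forall x, 0 <= e x by apply: patch_ge0 => x _; rewrite leey.
have me : measurable_fun setT e.
  by apply/(measurable_restrictT _ mN); exact: measurable_cst.
have h0' := patch_ge0 h0; have g0' := patch_ge0 g0.
have mh' : measurable_fun setT (h \_ D2) by apply/(measurable_restrictT _ mD2).
have -> : \int[mu]_(x in D2) h x = \int[mu]_x ((h \_ D2) x + e x).
  rewrite ge0_integralD// [X in _ + X](_ : _ = 0) ?adde0.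
    by rewrite [LHS]integral_mkcond.
  by rewrite -integral_mkcond integral_cst// N0 mule0.
rewrite [X in X <= _]integral_mkcond [X in _ <= X + _]integral_mkcond.
apply: ge0_le_integralDT => //; first exact: patch_ge0.
- by move=> x; rewrite adde_ge0.
- exact: emeasurable_funD.
- move=> x; have [Nx|Nx] := pselect (N x).
    rewrite /e (patchE (cst +oo)) mem_set//= addeA addey ?leey//.
    by rewrite gt_eqF// (@lt_le_trans _ _ 0)// adde_ge0.
  by apply: (le_trans (fgh _ Nx)); rewrite addeA leeDl.
Qed.

Lemma ge0_le_integral_ae (D D' N : set U) (f g : U -> \bar R) :
  (forall x, D x -> 0 <= f x) -> (forall x, D' x -> 0 <= g x) ->
  measurable N -> mu N = 0 ->
  (forall x, ~ N x -> D x -> D' x /\ f x <= g x) ->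
  \int[mu]_(x in D) f x <= \int[mu]_(x in D') g x.
Proof.
move=> f0 g0 mN N0 fg; rewrite -[leRHS]adde0 -(integral_set0 mu f).
apply: ge0_le_integralD_ae mN N0 _ => //; first exact: measurable_fun_set0.
move=> x /fg{}fg; rewrite [X in _ + X]patchE in_set0 adde0.
rewrite patchE; case: ifPn => [/set_mem/fg[D'x fgx]|_]; last exact: patch_ge0.
by rewrite patchE mem_set.
Qed.

End nonneg_integral.

Lemma squeeze_cvge0 (R : realType) (a b : (\bar R)^nat) :
  (forall k, 0 <= a k)%E -> (forall k, a k <= b k)%E ->
  b @ \oo --> 0%E -> a @ \oo --> 0%E.
Proof.
move=> a0 ab; apply: squeeze_cvge; last exact: cvg_cst.
by apply: nearW => k; rewrite a0 ab.
Qed.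

(** * Euclidean norm *)

Section enorm.
Context {R : realType} {m n : nat}.
Implicit Types A B : 'M[R]_(m, n).

Lemma enorm_ge0 A : 0 <= enorm A. Proof. exact: sqrtr_ge0. Qed.

Lemma enorm0 : enorm (0 : 'M[R]_(m, n)) = 0.
Proof.
rewrite /enorm big1 ?sqrtr0// => i _; rewrite big1// => j _.
by rewrite mxE expr0n.
Qed.

Lemma enorm_sqE A : enorm A ^+ 2 = \sum_(i < m) \sum_(j < n) A i j ^+ 2.
Proof. by rewrite sqr_sqrtr// !sumr_ge0// => i _; rewrite sumr_ge0// => j _; rewrite sqr_ge0. Qed.

Lemma enorm_eq0 A : enorm A <= 0 -> A = 0.
Proof.
move=> A0; have {}A0 : enorm A ^+ 2 = 0.
  by apply/eqP; rewrite sqrf_eq0 eq_le A0 enorm_ge0.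
apply/matrixP => i j; rewrite mxE; apply/eqP; rewrite -sqrf_eq0; apply/eqP.
have := A0; rewrite enorm_sqE => /psumr_eq0P H.
have /psumr_eq0P -> // := H (fun i _ => sumr_ge0 _ (fun j _ => sqr_ge0 _)) i isT.
by move=> k _; rewrite sqr_ge0.
Qed.

Lemma enormN A : enorm (- A) = enorm A.
Proof.
rewrite /enorm; congr Num.sqrt; apply: eq_bigr => i _; apply: eq_bigr => j _.
by rewrite mxE sqrrN.
Qed.

Lemma enorm_sqD A B : enorm (A + B) ^+ 2 <= 2 * enorm A ^+ 2 + 2 * enorm B ^+ 2.
Proof.
rewrite !enorm_sqE !mulr_sumr -big_split; apply: ler_sum => i _ /=.
rewrite !mulr_sumr -big_split; apply: ler_sum => j _ /=.
by rewrite mxE; have := sqr_ge0 (A i j - B i j); nra.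
Qed.

End enorm.

Lemma measurable_enorm_sq (R : realType) (disp : measure_display)
    (U : measurableType disp) (D : set U) (m n : nat) (A : U -> 'M[R]_(m, n)) :
  (forall i j, measurable_fun D (fun w => A w i j : measurableTypeR R)) ->
  measurable_fun D (fun w => (enorm (A w) ^+ 2)%:E).
Proof.
move=> mA; apply/measurable_EFinP.
under eq_fun do rewrite enorm_sqE.
apply: measurable_sum => i; apply: measurable_sum => j.
by apply: measurable_funX; exact: mA.
Qed.

Section mean_square.
Context {R : realType} {disp : measure_display} {Om : measurableType disp}.
Variable P : probability Om R.

Lemma expectation_enorm_sqD (m n : nat) (A B : Om -> 'M[R]_(m, n)) :
  (forall i j, measurable_fun setT (fun w => A w i j : measurableTypeR R)) ->
  (forall i j, measurable_fun setT (fun w => B w i j : measurableTypeR R)) ->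
  (\int[P]_w (enorm (A w + B w) ^+ 2)%:E <=
   2%:E * \int[P]_w (enorm (A w) ^+ 2)%:E +
   2%:E * \int[P]_w (enorm (B w) ^+ 2)%:E)%E.
Proof.
move=> mA mB; have mA2 := measurable_enorm_sq mA.
have mB2 := measurable_enorm_sq mB.
rewrite -!ge0_integralZl//; do ?by move=> w _; rewrite lee_fin sqr_ge0.
apply: ge0_le_integralDT => [w|w|w| |w].
- by rewrite lee_fin sqr_ge0.
- by rewrite mule_ge0// lee_fin ?sqr_ge0.
- by rewrite mule_ge0// lee_fin ?sqr_ge0.
- exact: measurable_funeM.
- by rewrite -!EFinM -EFinD lee_fin enorm_sqD.
Qed.

End mean_square.

(** * Filtration and progressive measurability *)

Lemma measurable_id_sub (U : pointedType) (G G' : set (set U)) :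
  G `<=` <<s G' >> ->
  measurable_fun [set: g_sigma_algebraType G']
    (id : g_sigma_algebraType G' -> g_sigma_algebraType G).
Proof.
move=> GG' _ A mA; rewrite setTI preimage_id.
by move: A mA; apply: smallest_sub => //; exact: smallest_sigma_algebra.
Qed.

Lemma measurable_id_coarser (disp : measure_display) (U : measurableType disp)
    (G : set (set U)) : G `<=` @measurable disp U ->
  measurable_fun [set: U] (id : U -> g_sigma_algebraType G).
Proof.
move=> GG' _ A mA; rewrite setTI preimage_id.
by move: A mA; apply: smallest_sub => //; exact: sigma_algebra_measurable.
Qed.

Section filtration.
Context {R : realType} {disp : measure_display} {Om : measurableType disp}.
Variables (P : probability Om R) (n : nat) (W : R -> Om -> 'cV[R]_n).
Local Notation F := (aug_filtration P W).

Lemma aug_filtration_mono (s t : R) : s <= t -> F s `<=` F t.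
Proof.
move=> st; apply: smallest_sub; first exact: smallest_sigma_algebra.
move=> A ssA; apply: sub_gen_smallest; move: A ssA.
move=> A [[r [i [B [/andP[r0 rs] mB ->]]]]|N]; last by right.
by left; exists r, i, B; split => //; rewrite r0 (le_trans rs).
Qed.

Lemma aug_filtration_mono_gen (s t : R) : s <= t -> F s `<=` <<s F t >>.
Proof.
by move=> st; apply: (subset_trans (aug_filtration_mono st)); exact: sub_gen_smallest.
Qed.

Lemma aug_filtration_null (t : R) (N : set Om) :
  measurable N -> P N = 0%E -> F t N.
Proof. by move=> mN N0; apply: sub_gen_smallest; right. Qed.

Lemma aug_filtration_measurable (t : R) :
  brownian_motion P W -> 0 <= t -> F t `<=` @measurable disp Om.
Proof.
move=> hW t0; apply: smallest_sub; first exact: sigma_algebra_measurable.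
move=> A [[r [i [B [/andP[r0 rs] mB ->]]]]|[]//].
by rewrite -[X in measurable X]setTI; apply: (bm_meas hW i r0).
Qed.

Lemma measurable_wrt_mono (s t : R) (p q : nat) (f : Om -> 'M[R]_(p, q)) :
  s <= t -> measurable_wrt (F s) f -> measurable_wrt (F t) f.
Proof.
move=> st mf i j.
exact: (measurableT_comp (mf i j) (measurable_id_sub (aug_filtration_mono_gen st))).
Qed.

Lemma measurable_wrt_measurable (t : R) (p q : nat) (f : Om -> 'M[R]_(p, q))
    i j : brownian_motion P W -> 0 <= t -> measurable_wrt (F t) f ->
  measurable_fun [set: Om] (fun w => f w i j : measurableTypeR R).
Proof.
move=> hW t0 mf.
exact: (measurableT_comp (mf i j)
  (measurable_id_coarser (aug_filtration_measurable hW t0))).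
Qed.

Lemma adaptedS (t1 t2 s1 s2 : R) (p q : nat) (H : R -> Om -> 'M[R]_(p, q)) :
  t1 <= s1 -> s2 <= t2 -> adapted F t1 t2 H -> adapted F s1 s2 H.
Proof.
move=> ts st aH t /andP[s1t ts2]; apply: aH.
by rewrite (le_trans ts) ?(le_trans ts2).
Qed.

Lemma measurable_wrt0 (t : R) (p q : nat) :
  measurable_wrt (F t) (fun _ => 0 : 'M[R]_(p, q)).
Proof.
by move=> i j; rewrite (_ : (fun _ => _) = cst (0 : R)) //; apply/funext => w; rewrite mxE.
Qed.

Lemma measurable_wrtD (t : R) (p q : nat) (f g : Om -> 'M[R]_(p, q)) :
  measurable_wrt (F t) f -> measurable_wrt (F t) g ->
  measurable_wrt (F t) (fun w => f w + g w).
Proof.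
move=> mf mg i j; under eq_fun do rewrite mxE.
exact: (measurable_funD (mf i j) (mg i j)).
Qed.

Lemma measurable_wrtB (t : R) (p q : nat) (f g : Om -> 'M[R]_(p, q)) :
  measurable_wrt (F t) f -> measurable_wrt (F t) g ->
  measurable_wrt (F t) (fun w => f w - g w).
Proof.
move=> mf mg i j; under eq_fun do rewrite !mxE.
exact: (measurable_funB (mf i j) (mg i j)).
Qed.

(** Changing an adapted random variable on a null event keeps it adapted because
    null events belong to every F_t. *)
Lemma measurable_wrt_if (t : R) (p q : nat) (N : set Om)
    (f g : Om -> 'M[R]_(p, q)) : measurable N -> P N = 0%E ->
  measurable_wrt (F t) f -> measurable_wrt (F t) g ->
  measurable_wrt (F t) (fun w => if w \in N then f w else g w).
Proof.
move=> mN N0 mf mg i j.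
have FN : (F t).-sigma.-measurable N.
  by apply: sub_gen_smallest; exact: aug_filtration_null.
rewrite (_ : (fun _ => _) = fun w : g_sigma_algebraType (F t) =>
    if w \in N then f w i j : measurableTypeR R else g w i j); last first.
  by apply/funext => w; case: ifP.
apply: measurable_fun_ifT => //.
apply: (measurable_fun_bool true).
rewrite setTI (_ : _ @^-1` _ = N)//.
by apply/seteqP; split => w /=; [exact: set_mem|exact: mem_set].
Qed.

Lemma progressiveS (t1 t2 s1 s2 : R) (p q : nat) (H : R -> Om -> 'M[R]_(p, q)) :
  t1 <= s1 -> s2 <= t2 -> progressive F t1 t2 H -> progressive F s1 s2 H.
Proof.
move=> ts st pH t /andP[s1t ts2] i j.
apply: measurable_funS (pH t _ i j).
- exact: measurableX.
- by move=> -[r w] [/= + _]; rewrite !in_itv/= => /andP[? ->]; rewrite (le_trans ts).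
- by rewrite (le_trans ts) ?(le_trans ts2).
Qed.

Lemma progressive0 (t1 t2 : R) (p q : nat) :
  progressive F t1 t2 (fun _ _ => 0 : 'M[R]_(p, q)).
Proof.
by move=> t _ i j; rewrite (_ : (fun _ => _) = cst (0 : R)) //; apply/funext => w; rewrite mxE.
Qed.

Lemma progressive_le (t1 t2 s t : R) (p q : nat) (H : R -> Om -> 'M[R]_(p, q))
    i j : progressive F t1 t2 H -> t1 <= s -> s <= t2 -> s <= t ->
  measurable_fun (`[t1, s] `*` [set: g_sigma_algebraType (F t)])
    (fun z : measurableTypeR R * g_sigma_algebraType (F t) =>
       H z.1 z.2 i j : measurableTypeR R).
Proof.
move=> pH t1s st2 st.
have := pH s _ i j; rewrite t1s st2 => /(_ isT) mH.
pose c (z : measurableTypeR R * g_sigma_algebraType (F t)) :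
  measurableTypeR R * g_sigma_algebraType (F s) := (z.1, z.2).
have mc : measurable_fun [set: _] c.
  apply: measurable_fun_pair; first exact: measurable_fst.
  apply: (measurableT_comp (measurable_id_sub (aug_filtration_mono_gen st))).
  exact: measurable_snd.
have mD : measurable (`[t1, s] `*` [set: g_sigma_algebraType (F s)]
    : set (measurableTypeR R * g_sigma_algebraType (F s))) by exact: measurableX.
apply: (measurable_comp mD _ mH (measurable_funTS mc)).
by move=> _ [z [/= zs _] <-].
Qed.

Lemma progressive_jointly_measurable (t1 t2 : R) (p q : nat)
    (H : R -> Om -> 'M[R]_(p, q)) i j :
  brownian_motion P W -> 0 <= t1 -> t1 <= t2 -> progressive F t1 t2 H ->
  measurable_fun (`[t1, t2] `*` [set: Om])
    (fun z : measurableTypeR R * Om => H z.1 z.2 i j : measurableTypeR R).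
Proof.
move=> hW t10 t12 pH.
have := pH t2 _ i j; rewrite t12 lexx => /(_ isT) mH.
pose c (z : measurableTypeR R * Om) :
  measurableTypeR R * g_sigma_algebraType (F t2) := (z.1, z.2).
have mc : measurable_fun [set: _] c.
  apply: measurable_fun_pair; first exact: measurable_fst.
  apply: (measurableT_comp (measurable_id_coarser
    (aug_filtration_measurable hW (le_trans t10 t12)))).
  exact: measurable_snd.
have mD : measurable (`[t1, t2] `*` [set: g_sigma_algebraType (F t2)]
    : set (measurableTypeR R * g_sigma_algebraType (F t2))) by exact: measurableX.
apply: (measurable_comp mD _ mH (measurable_funTS mc)).
by move=> _ [z [/= zs _] <-].
Qed.

(** Concatenation at time s of two progressive processes. On the null event N the
    result must still be measurable, and nothing is known there about processes
    that satisfy their equations only almost surely: hence the third process. *)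
Lemma progressive_paste (t1 s t2 : R) (p q : nat) (N : set Om)
    (H H' H0 K : R -> Om -> 'M[R]_(p, q)) :
  t1 <= s -> s <= t2 -> measurable N -> P N = 0%E ->
  progressive F t1 s H -> progressive F s t2 H' -> progressive F t1 t2 H0 ->
  (forall t w, N w -> t1 <= t <= t2 -> K t w = H0 t w) ->
  (forall t w, ~ N w -> t1 <= t <= s -> K t w = H t w) ->
  (forall t w, ~ N w -> s < t <= t2 -> K t w = H' t w) ->
  progressive F t1 t2 K.
Proof.
move=> t1s st2 mN N0 pH pH' pH0 KN KH KH' t /andP[t1t tt2] i j.
have FN : (F t).-sigma.-measurable N.
  by apply: sub_gen_smallest; exact: aug_filtration_null.
have FCN : (F t).-sigma.-measurable (~` N) by exact: measurableC.
pose ev (L : R -> Om -> 'M[R]_(p, q))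
  (z : measurableTypeR R * g_sigma_algebraType (F t)) : measurableTypeR R :=
  L z.1 z.2 i j.
pose A : set (measurableTypeR R * g_sigma_algebraType (F t)) := `[t1, t] `*` N.
pose B : set (measurableTypeR R * g_sigma_algebraType (F t)) :=
  `[t1, Num.min s t] `*` ~` N.
pose C : set (measurableTypeR R * g_sigma_algebraType (F t)) := `]s, t] `*` ~` N.
have mA : measurable A by exact: measurableX.
have mB : measurable B by exact: measurableX.
have mC : measurable C by exact: measurableX.
have sub : (`[t1, t] `*` [set: g_sigma_algebraType (F t)]) `<=` A `|` (B `|` C).
  move=> [r w] [/= + _]; rewrite in_itv/= => /andP[t1r rt].
  have [Nw|Nw] := pselect (N w); [left|right].
    by split => //=; rewrite in_itv/= t1r.
  have [rs|sr] := leP r s; [left|right]; split => //=; rewrite in_itv/=.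
    by rewrite t1r le_min rs rt.
  by rewrite sr rt.
apply: (measurable_funS (measurableU _ _ mA (measurableU _ _ mB mC)) sub).
apply/measurable_funU => //; first exact: measurableU.
split; last (apply/measurable_funU => //; split).
- apply: (eq_measurable_fun (ev H0)).
    move=> [r w] /set_mem[/=]; rewrite in_itv/= => /andP[t1r rt] Nw.
    by rewrite /ev /= KN// t1r (le_trans rt).
  apply: measurable_funS (progressive_le i j pH0 t1t tt2 (lexx t)) => //.
    exact: measurableX.
  by move=> [r w] [].
- apply: (eq_measurable_fun (ev H)).
    move=> [r w] /set_mem[/=]; rewrite in_itv/= le_min => /andP[t1r /andP[rs _]] Nw.
    by rewrite /ev /= KH// t1r.
  apply: (@measurable_funS _ _ _ _
    (`[t1, Num.min s t] `*` [set: g_sigma_algebraType (F t)])) => //.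
  + exact: measurableX.
  + by move=> [r w] [].
  + apply: progressive_le pH _ _ _; first by rewrite le_min t1s.
      by rewrite ge_min lexx.
    by rewrite ge_min lexx orbT.
- have [ts|st] := leP t s.
    rewrite (_ : C = set0); first exact: measurable_fun_set0.
    apply/seteqP; split => // -[r w] [/=]; rewrite in_itv/= => /andP[sr rt].
    by have := lt_le_trans sr (le_trans rt ts); rewrite ltxx.
  apply: (eq_measurable_fun (ev H')).
    move=> [r w] /set_mem[/=]; rewrite in_itv/= => /andP[sr rt] Nw.
    by rewrite /ev /= KH'// sr (le_trans rt).
  apply: measurable_funS (progressive_le i j pH' (ltW st) tt2 (lexx t)) => //.
    exact: measurableX.
  by move=> [r w] [/=]; rewrite !in_itv/= => /andP[/ltW -> ->].
Qed.

End filtration.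

(** * Simple processes and mean square norms *)

Section time_integral.
Context {R : realType} {disp : measure_display} {Om : measurableType disp}.
Local Notation mu := (@lebesgue_measure R).

Lemma measurable_section (t1 t2 : R) (p q : nat) (H : R -> Om -> 'M[R]_(p, q)) w :
  (forall i j, measurable_fun (`[t1, t2] `*` [set: Om])
     (fun z : measurableTypeR R * Om => H z.1 z.2 i j : measurableTypeR R)) ->
  measurable_fun (`[t1, t2] : set (measurableTypeR R))
    (fun s => (enorm (H s w) ^+ 2)%:E).
Proof.
move=> mH; apply: (measurable_enorm_sq (U := measurableTypeR R)) => i j.
have mD : measurable (`[t1, t2] `*` [set: Om] : set (measurableTypeR R * Om)).
  exact: measurableX.
apply: (measurable_comp mD _ (mH i j) (measurable_funTS (pair2_measurable w))).
by move=> _ [r /= rt <-].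
Qed.

Lemma measurable_time_integral (t1 t2 : R) (p q : nat)
    (H : R -> Om -> 'M[R]_(p, q)) :
  (forall i j, measurable_fun (`[t1, t2] `*` [set: Om])
     (fun z : measurableTypeR R * Om => H z.1 z.2 i j : measurableTypeR R)) ->
  measurable_fun [set: Om]
    (fun w => \int[mu]_(s in `[t1, t2]) (enorm (H s w) ^+ 2)%:E)%E.
Proof.
move=> mH.
have mD : measurable (`[t1, t2] `*` [set: Om] : set (measurableTypeR R * Om)).
  exact: measurableX.
pose h (z : measurableTypeR R * Om) : \bar R := (enorm (H z.1 z.2) ^+ 2)%:E.
have mh : measurable_fun [set: _] (h \_ (`[t1, t2] `*` [set: Om])).
  by apply/(measurable_restrictT _ mD); exact: measurable_enorm_sq.
have h0 z : (0 <= (h \_ (`[t1, t2] `*` [set: Om])) z)%E.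
  by apply: patch_ge0 => y _; rewrite lee_fin sqr_ge0.
have := measurable_fun_fubini_tonelli_G (m1 := mu) _ mh h0.
congr measurable_fun; apply/funext => w; rewrite /fubini_G [RHS]integral_mkcond.
apply: eq_integral => s _; rewrite !patchE in_setX /= in_setT andbT.
by case: ifP.
Qed.

End time_integral.

Section simple_processes.
Context {R : realType} {disp : measure_display} {Om : measurableType disp}.
Variables (P : probability Om R) (n : nat) (W : R -> Om -> 'cV[R]_n).
Local Notation F := (aug_filtration P W).
Local Notation mu := (@lebesgue_measure R).

Lemma measurable_simple_val (t1 t2 : R) (m : nat) (S : simple_process m n) i j :
  brownian_motion P W -> 0 <= t1 -> simple_on F t1 t2 S ->
  measurable_fun [set: measurableTypeR R * Om]
    (fun z : measurableTypeR R * Om =>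
       simple_val S z.1 z.2 i j : measurableTypeR R).
Proof.
move=> hW t10 hS; rewrite /simple_val.
under eq_fun do rewrite summxE big_mkcond.
apply: measurable_sum => k; have [t1a ab bt2 mxi _] := hS k.
apply: measurable_fun_ifT; last by [].
  by apply: measurable_and; [exact: measurable_fun_ltr|exact: measurable_fun_ler].
have mx := measurable_wrt_measurable i j hW (le_trans t10 t1a) mxi.
exact: (measurableT_comp mx measurable_snd).
Qed.

Lemma measurable_simple_int (t1 t2 t : R) (m : nat) (S : simple_process m n) i j :
  brownian_motion P W -> 0 <= t1 -> 0 <= t -> simple_on F t1 t2 S ->
  measurable_fun [set: Om] (fun w => simple_int W S t w i j : measurableTypeR R).
Proof.
move=> hW t10 t0 hS; rewrite /simple_int.
under eq_fun do rewrite summxE.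
apply: measurable_sum => k; have [t1a ab bt2 mxi _] := hS k.
have a0 : 0 <= sp_a k by exact: le_trans t1a.
have mx l := measurable_wrt_measurable i l hW a0 mxi.
under eq_fun do rewrite mxE.
apply: measurable_sum => l; apply: measurable_funM; first exact: mx.
under eq_fun do rewrite !mxE.
rewrite (ord1 j); apply: measurable_funB; apply: (bm_meas hW);
  by rewrite le_min t0 ?a0 ?(le_trans a0).
Qed.

(** The part of a simple process on (s1,s2]. An interval lying after s2 collapses
    to the point s2, where its coefficient need not be F_{s2}-measurable: it is
    replaced by 0. *)
Definition simple_clip (s1 s2 : R) (m : nat) (S : simple_process (Om := Om) m n) :
    simple_process m n :=
  SimpleProcess (fun k => Num.max s1 (Num.min (sp_a (s := S) k) s2))
    (fun k => Num.max s1 (Num.min (sp_b k) s2))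
    (fun k w => if sp_a k <= s2 then sp_xi k w else 0).

Lemma simple_on_clip (t1 t2 s1 s2 : R) (m : nat) (S : simple_process m n) :
  s1 <= s2 -> simple_on F t1 t2 S -> simple_on F s1 s2 (simple_clip s1 s2 S).
Proof.
move=> s12 hS k; have [t1a ab bt2 mxi [C hC]] := hS k; split => /=.
- by rewrite le_max lexx.
- rewrite ge_max le_max lexx /= le_max; apply/orP; right.
  by rewrite le_min !ge_min ab lexx orbT.
- by rewrite ge_max s12 ge_min lexx orbT.
- have [as2|as2] := leP (sp_a (s := S) k) s2; last exact: measurable_wrt0.
  by apply: measurable_wrt_mono mxi; rewrite le_max lexx orbT.
- exists (Num.max C 0) => w; case: ifPn => _; first by rewrite le_max hC.
  by rewrite enorm0 le_max lexx orbT.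
Qed.

Lemma simple_val_clip (s1 s2 s : R) (m : nat) (S : simple_process m n) w :
  s1 < s <= s2 -> simple_val (simple_clip s1 s2 S) s w = simple_val S s w.
Proof.
move=> /andP[s1s ss2]; rewrite /simple_val /=.
rewrite [LHS]big_mkcond [RHS]big_mkcond; apply: eq_bigr => k _ /=.
rewrite gt_max s1s /= gt_min le_max leNgt s1s /= le_min ss2 andbT.
rewrite [s2 < s]ltNge ss2 orbF; case: ifPn => // /andP[as_ _].
by rewrite (le_trans (ltW as_) ss2).
Qed.

Lemma simple_int_clip (t1 t2 s1 s2 t : R) (m : nat) (S : simple_process m n) w :
  simple_on F t1 t2 S -> s1 <= t <= s2 ->
  simple_int W (simple_clip s1 s2 S) t w
  = simple_int W S t w - simple_int W S s1 w.
Proof.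
move=> hS /andP[s1t ts2]; rewrite /simple_int /= -sumrB.
apply: eq_bigr => k _; have [_ ab _ _ _] := hS k; rewrite -mulmxBr.
have clipE c : W (Num.min (Num.max s1 (Num.min c s2)) t) w
    = W (Num.min c t) w - W (Num.min c s1) w + W s1 w.
  have [cs1|s1c] := leP c s1.
    by rewrite (min_l (le_trans cs1 (le_trans s1t ts2))) (max_l cs1) (min_l s1t)
      (min_l (le_trans cs1 s1t)) subrr add0r.
  rewrite subrK; congr (W _ w).
  have s1m : s1 <= Num.min c s2 by rewrite le_min (ltW s1c) (le_trans s1t).
  by rewrite (max_r s1m) -minA (min_r ts2).
case: ifPn => [as2|].
  congr (_ *m _); rewrite !clipE opprD addrACA subrr addr0.
  by rewrite !opprB [LHS]addrACA [RHS]addrACA; congr (_ + _); rewrite addrC.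
rewrite -ltNge => s2a; rewrite mul0mx.
have ta := le_lt_trans ts2 s2a; have s1a := le_lt_trans s1t ta.
rewrite (min_r (ltW ta)) (min_r (ltW (lt_le_trans ta ab))).
by rewrite (min_r (ltW s1a)) (min_r (ltW (lt_le_trans s1a ab))) !subrr mulmx0.
Qed.

Definition simple_cat (m : nat) (S S' : simple_process (R := R) (Om := Om) m n) :
    simple_process m n :=
  SimpleProcess (sp_size := sp_size S + sp_size S')
    (fun k => match fintype.split k with
              | inl i => sp_a (s := S) i | inr i => sp_a (s := S') i end)
    (fun k => match fintype.split k with
              | inl i => sp_b (s := S) i | inr i => sp_b (s := S') i end)
    (fun k => match fintype.split k with
              | inl i => sp_xi (s := S) i | inr i => sp_xi (s := S') i end).

Lemma split_lshift p q (k : 'I_p) : fintype.split (lshift q k) = inl k.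
Proof. exact: (unsplitK (inl k)). Qed.

Lemma split_rshift p q (k : 'I_q) : fintype.split (rshift p k) = inr k.
Proof. exact: (unsplitK (inr k)). Qed.

Lemma simple_on_cat (t1 s t2 : R) (m : nat) (S S' : simple_process m n) :
  t1 <= s -> s <= t2 -> simple_on F t1 s S -> simple_on F s t2 S' ->
  simple_on F t1 t2 (simple_cat S S').
Proof.
move=> t1s st2 hS hS' k; rewrite /simple_cat /=.
case: fintype.split => i.
  by have [? ? bs ? ?] := hS i; split => //; exact: le_trans bs st2.
by have [sa ? ? ? ?] := hS' i; split => //; exact: le_trans t1s sa.
Qed.

Lemma simple_val_cat (m : nat) (S S' : simple_process m n) t w :
  simple_val (simple_cat S S') t w = simple_val S t w + simple_val S' t w.
Proof.
rewrite /simple_val /= big_split_ord /=; congr (_ + _).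
  by apply: eq_big => [i|i _]; rewrite !split_lshift.
by apply: eq_big => [i|i _]; rewrite !split_rshift.
Qed.

Lemma simple_int_cat (m : nat) (S S' : simple_process m n) t w :
  simple_int W (simple_cat S S') t w = simple_int W S t w + simple_int W S' t w.
Proof.
rewrite /simple_int /= big_split_ord /=; congr (_ + _).
  by apply: eq_bigr => i _; rewrite !split_lshift.
by apply: eq_bigr => i _; rewrite !split_rshift.
Qed.

Lemma simple_val_before (t1 t2 t : R) (m : nat) (S : simple_process m n) w :
  simple_on F t1 t2 S -> t <= t1 -> simple_val S t w = 0.
Proof.
move=> hS tt1; rewrite /simple_val big1// => k /andP[at_ _].
have [t1a _ _ _ _] := hS k.
by have := lt_le_trans at_ (le_trans tt1 t1a); rewrite ltxx.
Qed.

Lemma simple_val_after (t1 t2 t : R) (m : nat) (S : simple_process m n) w :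
  simple_on F t1 t2 S -> t2 < t -> simple_val S t w = 0.
Proof.
move=> hS t2t; rewrite /simple_val big1// => k /andP[_ tb].
have [_ _ bt2 _ _] := hS k.
by have := lt_le_trans t2t (le_trans tb bt2); rewrite ltxx.
Qed.

Lemma simple_int_before (t1 t2 t : R) (m : nat) (S : simple_process m n) w :
  simple_on F t1 t2 S -> t <= t1 -> simple_int W S t w = 0.
Proof.
move=> hS tt1; rewrite /simple_int big1// => k _.
have [t1a ab _ _ _] := hS k; have ta := le_trans tt1 t1a.
by rewrite (min_r ta) (min_r (le_trans ta ab)) subrr mulmx0.
Qed.

Lemma simple_int_after (t1 t2 t : R) (m : nat) (S : simple_process m n) w :
  simple_on F t1 t2 S -> t2 <= t -> simple_int W S t w = simple_int W S t2 w.
Proof.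
move=> hS t2t; rewrite /simple_int; apply: eq_bigr => k _.
have [_ ab bt2 _ _] := hS k.
rewrite (min_l (le_trans bt2 t2t)) (min_l bt2).
by rewrite (min_l (le_trans ab (le_trans bt2 t2t))) (min_l (le_trans ab bt2)).
Qed.

Lemma sqnorm_L2_ge0 (t1 t2 : R) (p q : nat) (H : R -> Om -> 'M[R]_(p, q)) :
  (0 <= sqnorm_L2 P t1 t2 H)%E.
Proof. by apply: integral_ge0 => w _; apply: integral_ge0 => s _; rewrite lee_fin sqr_ge0. Qed.

(** The left endpoint of [s1,s2] may be left out because it is Lebesgue-null;
    clipped simple processes are only controlled on the half-open interval. *)
Lemma time_integralS (t1 t2 s1 s2 : R) (h k : R -> R) :
  t1 <= s1 -> s2 <= t2 -> (forall s, 0 <= h s) -> (forall s, 0 <= k s) ->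
  (forall s, s1 < s <= s2 -> k s = h s) ->
  (\int[mu]_(s in `[s1, s2]) (k s)%:E <= \int[mu]_(s in `[t1, t2]) (h s)%:E)%E.
Proof.
move=> ts st h0 k0 kh.
apply: (ge0_le_integral_ae (U := measurableTypeR R) (N := [set s1])) => //.
- by move=> r _; rewrite lee_fin.
- by move=> r _; rewrite lee_fin.
- exact: lebesgue_measure_set1.
- move=> r /eqP rs1; rewrite /= !in_itv/= => /andP[s1r rs2].
  rewrite (le_trans ts) ?(le_trans rs2)//; split => //.
  by rewrite kh// rs2 lt_neqAle s1r eq_sym rs1.
Qed.

Lemma sqnorm_L2S (t1 t2 s1 s2 : R) (p q : nat) (H K : R -> Om -> 'M[R]_(p, q)) :
  t1 <= s1 -> s2 <= t2 ->
  (forall s w, s1 < s <= s2 -> K s w = H s w) ->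
  (sqnorm_L2 P s1 s2 K <= sqnorm_L2 P t1 t2 H)%E.
Proof.
move=> ts st KH; apply: ge0_le_integralT => w.
  by apply: integral_ge0 => s _; rewrite lee_fin sqr_ge0.
by apply: time_integralS => // s; rewrite ?sqr_ge0// => /(KH _ w)->.
Qed.

Lemma time_integral_paste (t1 s t2 : R) (h h' k : R -> R) :
  t1 <= s -> s <= t2 -> (forall r, 0 <= h r) -> (forall r, 0 <= h' r) ->
  (forall r, 0 <= k r) ->
  measurable_fun (`[s, t2] : set (measurableTypeR R)) (fun r => (h' r)%:E) ->
  (forall r, t1 <= r <= s -> k r = h r) ->
  (forall r, s < r <= t2 -> k r = h' r) ->
  (\int[mu]_(r in `[t1, t2]) (k r)%:E <=
   \int[mu]_(r in `[t1, s]) (h r)%:E + \int[mu]_(r in `[s, t2]) (h' r)%:E)%E.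
Proof.
move=> t1s st2 h0 h'0 k0 mh' kh kh'.
apply: (ge0_le_integralD_ae (U := measurableTypeR R) (N := set0)) => //;
  do ?by move=> r _; rewrite lee_fin.
have pt0 : point = 0%E :> \bar R by [].
move=> r _; rewrite !patchE !mem_setE !in_itv/= pt0.
have [t1r|rt1] /= := leP t1 r; last first.
  by rewrite add0e; case: ifP; rewrite ?lee_fin.
have [rs|sr] := leP r s.
  by rewrite (le_trans rs st2) kh ?t1r// leeDl//; case: ifP; rewrite ?lee_fin.
rewrite (ltW sr) add0e /=; case: ifP => // rt2.
by rewrite kh'// sr.
Qed.

Lemma sqnorm_L2_paste (t1 s t2 : R) (p q : nat) (N : set Om)
    (H H' K : R -> Om -> 'M[R]_(p, q)) :
  t1 <= s -> s <= t2 -> measurable N -> P N = 0%E ->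
  (forall i j, measurable_fun (`[s, t2] `*` [set: Om])
     (fun z : measurableTypeR R * Om => H' z.1 z.2 i j : measurableTypeR R)) ->
  (forall r w, ~ N w -> t1 <= r <= s -> K r w = H r w) ->
  (forall r w, ~ N w -> s < r <= t2 -> K r w = H' r w) ->
  (sqnorm_L2 P t1 t2 K <= sqnorm_L2 P t1 s H + sqnorm_L2 P s t2 H')%E.
Proof.
move=> t1s st2 mN N0 mH' KH KH'.
have int0 a c (L : R -> Om -> 'M[R]_(p, q)) w :
    (0 <= \int[mu]_(r in `[a, c]) (enorm (L r w) ^+ 2)%:E)%E.
  by apply: integral_ge0 => r _; rewrite lee_fin sqr_ge0.
apply: (ge0_le_integralD_ae (N := N)) => //.
  exact: measurable_time_integral.
move=> w Nw; rewrite !patch_setT; apply: time_integral_paste => //.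
- by move=> r; rewrite sqr_ge0.
- by move=> r; rewrite sqr_ge0.
- by move=> r; rewrite sqr_ge0.
- exact: measurable_section.
- by move=> r /(KH _ _ Nw)->.
- by move=> r /(KH' _ _ Nw)->.
Qed.

End simple_processes.

(** * Restriction and concatenation of integral equations *)

Lemma within_continuous_paste (R : realType) (U : topologicalType) (t1 s t2 : R)
    (h h' k : R -> U) : t1 <= s -> s <= t2 ->
  {within `[t1, s], continuous h} -> {within `[s, t2], continuous h'} ->
  (forall r, t1 <= r <= s -> k r = h r) ->
  (forall r, s <= r <= t2 -> k r = h' r) ->
  {within `[t1, t2], continuous k}.
Proof.
move=> t1s st2 ch ch' kh kh'.
apply: (@continuous_subspaceW _ _ _ (`[t1, s] `|` `[s, t2])).
  move=> r /=; rewrite !in_itv/= => /andP[t1r rt2].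
  by have [rs|/ltW sr] := leP r s; [left; rewrite t1r|right; rewrite sr].
apply: withinU_continuous; [exact: itv_closed|exact: itv_closed| |].
- apply: subspace_eq_continuous ch => r /set_mem/=.
  by rewrite in_itv/= => /kh.
- apply: subspace_eq_continuous ch' => r /set_mem/=.
  by rewrite in_itv/= => /kh'.
Qed.

Section drift.
Context {R : realType}.
Local Notation mu := (@lebesgue_measure R).
Implicit Types h k : R -> R.

Lemma integrable_itvS (t1 t2 s1 s2 : R) h : t1 <= s1 -> s2 <= t2 ->
  mu.-integrable `[t1, t2] (fun r => (h r)%:E) ->
  mu.-integrable `[s1, s2] (fun r => (h r)%:E).
Proof.
move=> ts st; apply: integrableS => // r /=.
by rewrite !in_itv/= => /andP[s1r rs2]; rewrite (le_trans ts) ?(le_trans rs2).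
Qed.

Lemma integrable_itv_paste (t1 s t2 : R) h h' k : t1 <= s -> s <= t2 ->
  mu.-integrable `[t1, s] (fun r => (h r)%:E) ->
  mu.-integrable `[s, t2] (fun r => (h' r)%:E) ->
  (forall r, t1 <= r <= s -> k r = h r) ->
  (forall r, s < r <= t2 -> k r = h' r) ->
  mu.-integrable `[t1, t2] (fun r => (k r)%:E).
Proof.
move=> t1s st2 ih ih' kh kh'.
have mI : measurable (`[t1, t2] : set (measurableTypeR R)) by [].
apply: (eq_integrable mI (((fun r => (h r)%:E) \_ `[t1, s]) \+
                          ((fun r => (h' r)%:E) \_ `]s, t2]))%E).
  have pt0 : point = 0%E :> \bar R by [].
  move=> r; rewrite mem_setE in_itv/= => /andP[t1r rt2].
  rewrite !patchE !mem_setE !in_itv/= t1r rt2 andbT pt0 /=.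
  have [rs|sr] := leP r s; first by rewrite adde0 kh ?t1r.
  by rewrite add0e kh' ?sr.
apply: integrableD => //; apply/integrable_restrict => //.
  by apply: integrableS ih; [|exact: measurableI|exact: subIsetr].
apply: integrableS ih'; [by []|exact: measurableI|].
by move=> r [_] /=; rewrite !in_itv/= => /andP[/ltW -> ->].
Qed.

Lemma Rintegral_itv_cat (t1 s t2 : R) h : t1 <= s -> s <= t2 ->
  mu.-integrable `[t1, t2] (fun r => (h r)%:E) ->
  \int[mu]_(r in `[t1, t2]) h r
  = \int[mu]_(r in `[t1, s]) h r + \int[mu]_(r in `[s, t2]) h r.
Proof.
move=> t1s st2 ih.
have := Rintegral_itvB ih (x := s); rewrite !bnd_simp => /(_ t1s st2) /eqP.
rewrite subr_eq => /eqP ->; rewrite addrC Rintegral_itv_obnd_cbnd//.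
apply: integrableS ih => // r /=.
by rewrite !in_itv/= => /andP[/ltW/(le_trans t1s) -> ->].
Qed.

Lemma eq_Rintegral_oitv (s t : R) h k :
  mu.-integrable `[s, t] (fun r => (h r)%:E) ->
  (forall r, s < r <= t -> k r = h r) ->
  \int[mu]_(r in `[s, t]) k r = \int[mu]_(r in `[s, t]) h r.
Proof.
move=> ih kh.
have mI : measurable (`]s, t] : set (measurableTypeR R)) by [].
have ih' : mu.-integrable `]s, t] (EFin \o h).
  by apply: integrableS ih => // r /=; rewrite !in_itv/= => /andP[/ltW -> ->].
have ik : mu.-integrable `]s, t] (EFin \o k).
  apply: (eq_integrable mI (EFin \o h) _ _ ih') => r.
  by rewrite mem_setE in_itv/= => /kh ->.
rewrite -!Rintegral_itv_obnd_cbnd//; apply: eq_Rintegral => r.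
by rewrite mem_setE in_itv/= => /kh ->.
Qed.

End drift.

Lemma cvge0D (R : realType) (a b : (\bar R)^nat) :
  a @ \oo --> 0%E -> b @ \oo --> 0%E -> (fun k => a k + b k)%E @ \oo --> 0%E.
Proof. by move=> a0 b0; rewrite -[X in _ --> X]adde0; exact: cvgeD. Qed.

Lemma cvge0_lin2 (R : realType) (a b : (\bar R)^nat) :
  a @ \oo --> 0%E -> b @ \oo --> 0%E ->
  (fun k => 2%:E * a k + 2%:E * b k)%E @ \oo --> 0%E.
Proof.
move=> a0 b0.
by apply: cvge0D; rewrite -[X in _ --> X](mule0 (2%:E : \bar R)); exact: cvgeZl.
Qed.

Section ito.
Context {R : realType} {disp : measure_display} {Om : measurableType disp}.
Variables (P : probability Om R) (n : nat) (W : R -> Om -> 'cV[R]_n).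
Hypothesis hW : brownian_motion P W.
Local Notation F := (aug_filtration P W).
Local Notation mu := (@lebesgue_measure R).

Let measurable_error (t1 t2 t : R) (m : nat) (M : R -> Om -> 'cV[R]_m)
    (S : simple_process m n) :
  0 <= t1 -> t1 <= t <= t2 -> adapted F t1 t2 M -> simple_on F t1 t2 S ->
  forall i j, measurable_fun [set: Om]
    (fun w => (M t w - simple_int W S t w) i j : measurableTypeR R).
Proof.
move=> t10 t12 aM hS i j; under eq_fun do rewrite !mxE.
have /andP[t1t _] := t12; have t0 := le_trans t10 t1t.
apply: measurable_funB; first exact: measurable_wrt_measurable hW t0 (aM t t12).
have := measurable_simple_int i j hW t10 t0 hS.
by under eq_fun do rewrite /simple_int summxE.
Qed.

(** The integral from s1 is M - M_{s1}. Clipping the approximating simple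
    processes to [s1,s2] does not increase the mean square error of the integrands
    and turns their integrals into increments since s1. *)
Lemma ito_integralS (t1 t2 s1 s2 : R) (m : nat) (H : R -> Om -> 'M[R]_(m, n))
    (M : R -> Om -> 'cV[R]_m) :
  0 <= t1 -> t1 <= s1 -> s1 <= s2 -> s2 <= t2 ->
  ito_integral P W t1 t2 H M ->
  ito_integral P W s1 s2 H (fun t w => M t w - M s1 w).
Proof.
move=> t10 ts s12 st [pH fH aM cM [S [hS cvS cvM]]].
have t1s12 : t1 <= s1 <= t2 by rewrite ts (le_trans s12).
split.
- exact: progressiveS pH.
- apply: le_lt_trans fH; exact: sqnorm_L2S.
- move=> t /andP[s1t ts2]; apply: measurable_wrtB.
    by apply: aM; rewrite (le_trans ts) ?(le_trans ts2).
  by apply: measurable_wrt_mono s1t _; exact: aM.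
- apply: filterS cM => w cw r.
  apply: cvgB; last exact: cvg_cst.
  apply: (continuous_subspaceW _ cw) => q /=; rewrite !in_itv/= => /andP[s1q qs2].
  by rewrite (le_trans ts) ?(le_trans qs2).
- exists (fun k => simple_clip s1 s2 (S k)); split.
  + by move=> k; exact: simple_on_clip.
  + apply: squeeze_cvge0 cvS => k; first exact: sqnorm_L2_ge0.
    by apply: sqnorm_L2S => // s w s12'; rewrite simple_val_clip.
  + move=> t s1ts2; have /andP[s1t ts2] := s1ts2.
    have t1tt2 : t1 <= t <= t2 by rewrite (le_trans ts) ?(le_trans ts2).
    apply: squeeze_cvge0 (cvge0_lin2 (cvM _ t1tt2) (cvM _ t1s12)) => k.
      by apply: integral_ge0 => w _; rewrite lee_fin sqr_ge0.
    have e1 := measurable_error t10 t1tt2 aM (hS k).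
    have e2 := measurable_error t10 t1s12 aM (hS k).
    under [X in (_ <= _ + _ * X)%E]eq_integral do rewrite -enormN.
    apply: le_trans (expectation_enorm_sqD P e1 _); last first.
      move=> i j; under eq_fun do rewrite mxE.
      exact: measurableT_comp (e2 i j).
    rewrite le_eqVlt; apply/orP; left; apply/eqP; apply: eq_integral => w _.
    congr (enorm _ ^+ 2)%:E; rewrite (simple_int_clip _ (hS k))//.
    by rewrite !opprB [RHS]addrACA [LHS]addrACA; congr (_ + _); rewrite addrC.
Qed.

(** Each simple process of the two approximating sequences vanishes outside its
    own interval, so that the errors of the concatenated simple processes add up.
    Errors are expectations: agreement of the integrands off a null event is
    enough. *)
Lemma ito_integral_paste (t1 s t2 : R) (m : nat) (N : set Om)
    (H H' K : R -> Om -> 'M[R]_(m, n)) (M M' : R -> Om -> 'cV[R]_m) :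
  0 <= t1 -> t1 <= s -> s <= t2 -> measurable N -> P N = 0%E ->
  ito_integral P W t1 s H M -> ito_integral P W s t2 H' M' ->
  progressive F t1 t2 K ->
  (forall r w, ~ N w -> t1 <= r <= s -> K r w = H r w) ->
  (forall r w, ~ N w -> s < r <= t2 -> K r w = H' r w) ->
  ito_integral P W t1 t2 K
    (fun t w => if t <= s then M t w else M s w + (M' t w - M' s w)).
Proof.
move=> t10 t1s st2 mN N0 [pH fH aM cM [S [hS cvS cvM]]].
move=> [pH' fH' aM' cM' [S' [hS' cvS' cvM']]] pK KH KH'.
have s0 := le_trans t10 t1s.
have ss1 : t1 <= s <= s by rewrite t1s lexx.
have ss2 : s <= s <= t2 by rewrite lexx.
have mH' i j := progressive_jointly_measurable i j hW s0 st2 pH'.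
split; first exact: pK.
- apply: le_lt_trans (sqnorm_L2_paste t1s st2 mN N0 mH' KH KH') _.
  by apply: lte_add_pinfty; [exact: fH|exact: fH'].
- move=> t /andP[t1t tt2]; case: (leP t s) => [ts|/ltW st].
    by apply: aM; rewrite t1t.
  apply: measurable_wrtD; first by apply: measurable_wrt_mono st _; exact: aM.
  apply: measurable_wrtB; first by apply: aM'; rewrite st.
  by apply: measurable_wrt_mono st _; exact: aM'.
- apply: filterS2 cM cM' => w cw cw'.
  apply: (within_continuous_paste (s := s) (h := M ^~ w)
    (h' := fun t => M s w + (M' t w - M' s w))) => //.
  + move=> r; apply: cvgD; first exact: cvg_cst.
    by apply: cvgB; [exact: cw'|exact: cvg_cst].
  + by move=> r /andP[_ ->].
  + move=> r /andP[sr _]; case: ifP => // rs.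
    by have -> : r = s; [apply/eqP; rewrite eq_le rs|rewrite subrr addr0].
- exists (fun k => simple_cat (S k) (S' k)); split.
  + by move=> k; exact: simple_on_cat t1s st2 (hS k) (hS' k).
  + apply: (@squeeze_cvge0 _ _ (fun k => (sqnorm_L2 P t1 s
        (fun r w => H r w - simple_val (S k) r w)%R +
      sqnorm_L2 P s t2 (fun r w => H' r w - simple_val (S' k) r w)%R)%E)).
    * by move=> k; exact: sqnorm_L2_ge0.
    * move=> k.
      pose D r w := H r w - simple_val (S k) r w.
      pose D' r w := H' r w - simple_val (S' k) r w.
      apply: (sqnorm_L2_paste (H := D) (H' := D') t1s st2 mN N0);
        rewrite /D /D'.
      - move=> i j; under [X in measurable_fun _ X]eq_fun do rewrite !mxE.
        apply: measurable_funB; first exact: mH'.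
        exact: measurable_funTS (measurable_simple_val i j hW s0 (hS' k)).
      - move=> r w Nw /andP[t1r rs]; rewrite KH ?t1r// simple_val_cat.
        by rewrite (simple_val_before _ (hS' k) rs) addr0.
      - move=> r w Nw /andP[sr rt2]; rewrite KH' ?sr// simple_val_cat.
        by rewrite (simple_val_after _ (hS k) sr) add0r.
    * exact: cvge0D cvS cvS'.
  + move=> t /andP[t1t tt2].
    have [ts|st] := leP t s.
      have t1ts : t1 <= t <= s by rewrite t1t.
      apply: squeeze_cvge0 (cvM _ t1ts) => k.
        by apply: integral_ge0 => w _; rewrite lee_fin sqr_ge0.
      rewrite le_eqVlt; apply/orP; left; apply/eqP; apply: eq_integral => w _.
      by rewrite simple_int_cat (simple_int_before _ (hS' k) ts) addr0.
    have stt2 : s <= t <= t2 by rewrite (ltW st).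
    apply: squeeze_cvge0 (cvge0_lin2 (cvM _ ss1)
      (cvge0_lin2 (cvM' _ stt2) (cvM' _ ss2))) => k.
      by apply: integral_ge0 => w _; rewrite lee_fin sqr_ge0.
    have e1 := measurable_error t10 ss1 aM (hS k).
    have e2 := measurable_error s0 stt2 aM' (hS' k).
    have e3 i j : measurable_fun [set: Om]
        (fun w => (- (M' s w - simple_int W (S' k) s w)) i j).
      under eq_fun do rewrite mxE.
      exact: measurableT_comp (measurable_error s0 ss2 aM' (hS' k) i j).
    under [X in (_ <= _ + _ * (_ + _ * X))%E]eq_integral do rewrite -enormN.
    apply: (le_trans _ (leeD2l _ (lee_wpmul2l _ (expectation_enorm_sqD P e2 e3)))) => //.
    apply: le_trans (expectation_enorm_sqD P e1 _); last first.
      by move=> i j; under eq_fun do rewrite mxE; exact: measurable_funD (e2 i j) (e3 i j).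
    rewrite le_eqVlt; apply/orP; left; apply/eqP; apply: eq_integral => w _.
    congr (enorm _ ^+ 2)%:E; rewrite simple_int_cat.
    rewrite (simple_int_after _ (hS k) (ltW st)).
    rewrite (simple_int_before _ (hS' k) (lexx s)) subr0.
    by rewrite opprD [LHS]addrACA; congr (_ + _); rewrite addrAC.
Qed.

Lemma ito_equationS (t1 t2 s1 s2 : R) (m : nat) (V beta : R -> Om -> 'cV[R]_m)
    (H : R -> Om -> 'M[R]_(m, n)) :
  0 <= t1 -> t1 <= s1 -> s1 <= s2 -> s2 <= t2 ->
  ito_equation P W t1 t2 V beta H -> ito_equation P W s1 s2 V beta H.
Proof.
move=> t10 ts s12 st [ib [M iM eqV]]; split.
  by apply: filterS ib => w ib i; exact: integrable_itvS (ib i).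
exists (fun t w => M t w - M s1 w); first exact: ito_integralS iM.
apply: filterS2 ib eqV => w ib eqV t /andP[s1t ts2].
have t1tt2 : t1 <= t <= t2 by rewrite (le_trans ts) ?(le_trans ts2).
have t1s12 : t1 <= s1 <= t2 by rewrite ts (le_trans s12).
rewrite eqV// (eqV _ t1s12).
have -> : \col_i \int[mu]_(r in `[t1, t]) beta r w i 0 =
    (\col_i \int[mu]_(r in `[t1, s1]) beta r w i 0) +
    (\col_i \int[mu]_(r in `[s1, t]) beta r w i 0).
  apply/matrixP => i j; rewrite !mxE; apply: Rintegral_itv_cat => //.
  by apply: integrable_itvS (ib i) => //; exact: le_trans ts2 st.
by rewrite -!addrA; congr (_ + (_ + _)); rewrite addrCA [M s1 w + _]addrC subrK addrC.
Qed.

(** Both ways of evaluating at s, as the end of the first interval and as the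
    start of the second one, agree because U extends V and V' on closed
    intervals. *)
Lemma ito_equation_paste (t1 s t2 : R) (m : nat) (N : set Om)
    (V V' U beta beta' gamma : R -> Om -> 'cV[R]_m)
    (H H' K : R -> Om -> 'M[R]_(m, n)) :
  0 <= t1 -> t1 <= s -> s <= t2 -> measurable N -> P N = 0%E ->
  ito_equation P W t1 s V beta H -> ito_equation P W s t2 V' beta' H' ->
  progressive F t1 t2 K ->
  (forall w, ~ N w ->
     [/\ forall r, t1 <= r <= s -> U r w = V r w /\ gamma r w = beta r w,
         forall r, s <= r <= t2 -> U r w = V' r w
       & forall r, s < r <= t2 -> gamma r w = beta' r w]) ->
  (forall r w, ~ N w -> t1 <= r <= s -> K r w = H r w) ->
  (forall r w, ~ N w -> s < r <= t2 -> K r w = H' r w) ->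
  ito_equation P W t1 t2 U gamma K.
Proof.
move=> t10 t1s st2 mN N0 [ib [M iM eqV]] [ib' [M' iM' eqV']] pK eqN KH KH'.
have aeN : {ae P, forall w, ~ N w}.
  by exists N; split => // w; exact: contrapT.
have ig : {ae P, forall w, forall i,
    mu.-integrable `[t1, t2] (fun r => (gamma r w i 0)%:E)}.
  apply: filterS3 aeN ib ib' => w /eqN[eq1 _ eq2] ib ib' i.
  apply: integrable_itv_paste (ib i) (ib' i) _ _ => // r.
    by move=> /eq1[_ ->].
  by move=> /eq2 ->.
split; first exact: ig.
exists (fun t w => if t <= s then M t w else M s w + (M' t w - M' s w)).
  exact: (ito_integral_paste t10 t1s st2 mN N0 iM iM' pK KH KH').
apply: filterS3 (filterI aeN ig) eqV (filterI ib' eqV') => w.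
move=> [/eqN[eq1 eq2 eq3] igw] eqVw [ib'w eqV'w].
move=> t /andP[t1t tt2].
have ss2 : s <= s <= t2 by rewrite lexx.
have Ut1 : U t1 w = V t1 w by apply: (eq1 t1 _).1; rewrite lexx.
rewrite Ut1; have [ts|st] := leP t s.
  have t1ts : t1 <= t <= s by rewrite t1t.
  rewrite (eq1 t t1ts).1 eqVw//; congr (_ + _ + _).
  apply/matrixP => i j; rewrite !mxE; apply: eq_Rintegral => r.
  rewrite mem_setE in_itv/= => /andP[t1r rt].
  by rewrite (eq1 r _).2// t1r (le_trans rt).
have stt2 : s <= t <= t2 by rewrite (ltW st).
have Vs : V' s w = V s w.
  by rewrite -(eq2 _ ss2) (eq1 s _).1// t1s lexx.
(* The second equation at its own starting time says that M' starts at 0. *)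
have M's : M' s w = 0.
  have := eqV'w s ss2; rewrite -[LHS]addr0 -addrA => /addrI.
  rewrite [X in _ = X + _](_ : _ = 0) ?add0r//.
  by apply/matrixP => i j; rewrite !mxE set_itv1 Rintegral_set1.
rewrite (eq2 t stt2) eqV'w// Vs M's subr0 eqVw ?t1s ?lexx//.
have -> : \col_i \int[mu]_(r in `[t1, t]) gamma r w i 0 =
    (\col_i \int[mu]_(r in `[t1, s]) beta r w i 0) +
    (\col_i \int[mu]_(r in `[s, t]) beta' r w i 0).
  apply/matrixP => i j; rewrite !mxE (Rintegral_itv_cat t1s (ltW st)).
    congr (_ + _).
      apply: eq_Rintegral => r; rewrite mem_setE in_itv/= => r12.
      by rewrite (eq1 r r12).2.
    apply: eq_Rintegral_oitv; first exact: integrable_itvS (ib'w i).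
    by move=> r /andP[sr rt]; rewrite eq3// sr (le_trans rt).
  exact: integrable_itvS (igw i).
by rewrite -!addrA; congr (_ + (_ + _)); rewrite addrCA.
Qed.

End ito.

(** * Dependence on the past of a path *)

Section pnorm.
Context {R : realType}.

Lemma eq_pnorm (d : nat) (t : R) (x x' : R -> 'cV[R]_d) : 0 <= t ->
  (forall s, 0 <= s <= t -> x s = x' s) -> pnorm t x = pnorm t x'.
Proof.
move=> t0 xx'; rewrite /pnorm; have -> : x t = x' t by apply: xx'; rewrite t0 lexx.
rewrite (_ : \int[_]_(s in _) _ =
  \int[lebesgue_measure]_(s in `[0, t]) (enorm (x' s) ^+ 2))//.
apply: eq_Rintegral => s; rewrite mem_setE in_itv/=.
by move=> /xx' ->.
Qed.

Lemma pnorm0 (d : nat) (t : R) : pnorm t (fun _ => 0 : 'cV[R]_d) = 0.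
Proof.
by rewrite /pnorm !enorm0 expr0n /= Rintegral_cst// mul0r addr0 sqrtr0.
Qed.

(** The seminorm of the Lipschitz bound at time t only sees the path on [0,t]. *)
Lemma lipschitz_nonanticipative (T K : R) (d n p q : nat)
    (disp : measure_display) (U : measurableType disp)
    (xi : R -> U -> cpath T d -> 'cV[R]_n -> 'M[R]_n -> 'M[R]_(p, q))
    t w (x x' : cpath T d) y z :
  lipschitz_coef K xi -> 0 <= t <= T ->
  (forall s, 0 <= s <= t -> x s = x' s) -> xi t w x y z = xi t w x' y z.
Proof.
move=> Lxi t0T xx'; apply/eqP; rewrite -subr_eq0; apply/eqP/enorm_eq0.
apply: (le_trans (Lxi t w x x' y y z z t0T)).
rewrite !subrr !enorm0 !addr0 (_ : pnorm _ _ = 0) ?mulr0//.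
have /andP[t0 _] := t0T.
rewrite -(pnorm0 d t); apply: eq_pnorm => // s /xx' ->.
by rewrite subrr.
Qed.

End pnorm.

(** * Restriction and concatenation of solutions *)

Section solutions.
Context {R : realType} {disp : measure_display} {Om : measurableType disp}.
Variables (P : probability Om R) (d n : nat) (W : R -> Om -> 'cV[R]_n) (T : R).
Hypothesis hW : brownian_motion P W.
Local Notation C := (cpath T d).
Local Notation F := (aug_filtration P W).
Local Notation mu := (@lebesgue_measure R).
Variables (b : R -> Om -> C -> 'cV[R]_n -> 'M[R]_n -> 'cV[R]_d)
          (sigma : R -> Om -> C -> 'cV[R]_n -> 'M[R]_n -> 'M[R]_(d, n))
          (f : R -> Om -> C -> 'cV[R]_n -> 'M[R]_n -> 'cV[R]_n).
Local Notation solution := (fbsde_solution P W b sigma f).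

Let energy (t t2 : R) (X : Om -> C) (Y : R -> Om -> 'cV[R]_n)
    (Z : R -> Om -> 'M[R]_n) (w : Om) : \bar R :=
  ((pnorm t (X w) ^+ 2 + enorm (Y t w) ^+ 2)%:E
   + \int[mu]_(s in `[t, t2]) (enorm (Z s w) ^+ 2)%:E)%E.

Let tail_ge0 (t t2 : R) (Z : R -> Om -> 'M[R]_n) (w : Om) :
  (0 <= \int[mu]_(s in `[t, t2]) (enorm (Z s w) ^+ 2)%:E)%E.
Proof. by apply: integral_ge0 => s _; rewrite lee_fin sqr_ge0. Qed.

Let energy_ge0 t t2 X Y Z w : (0 <= energy t t2 X Y Z w)%E.
Proof. by rewrite adde_ge0// lee_fin addr_ge0// sqr_ge0. Qed.

(** Initial and terminal data of the restriction are free as long as the given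
    solution attains them almost surely: this lets the decoupling relation at an
    intermediate time serve as a terminal condition. *)
Lemma solutionS (t1 t2 s1 s2 : R) (x x' : Om -> C) (h h' : Om -> C -> 'cV[R]_n)
    (X : Om -> C) (Y : R -> Om -> 'cV[R]_n) (Z : R -> Om -> 'M[R]_n) :
  0 <= t1 -> t1 <= s1 -> s1 <= s2 -> s2 <= t2 ->
  solution t1 t2 x h X Y Z ->
  {ae P, forall w, forall t : R, 0 <= t <= s1 -> X w t = x' w t} ->
  {ae P, forall w, Y s2 w = h' w (X w)} ->
  solution s1 s2 x' h' X Y Z.
Proof.
move=> t10 ts s12 st [aX aY cY pZ _ eX eY _ bd] ix' th'; split.
- exact: adaptedS aX.
- exact: adaptedS aY.
- move=> w; apply: continuous_subspaceW (cY w) => q /=.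
  by rewrite !in_itv/= => /andP[s1q qs2]; rewrite (le_trans ts) ?(le_trans qs2).
- exact: progressiveS pZ.
- exact: ix'.
- exact: ito_equationS eX.
- exact: ito_equationS eY.
- exact: th'.
- apply: le_lt_trans bd; apply: ge_ereal_sup => _ [t /= + <-].
  rewrite in_itv/= => /andP[s1t ts2].
  apply: (@le_trans _ _ (\int[P]_w energy t t2 X Y Z w)%E).
    apply: ge0_le_integralT => w; first exact: energy_ge0.
    rewrite leeD2l//; apply: time_integralS => // s; exact: sqr_ge0.
  apply: ereal_sup_ubound; exists t => //=.
  by rewrite in_itv/= (le_trans ts) ?(le_trans ts2).
Qed.

Lemma solution_H2 (t1 t2 s : R) (x : Om -> C) (h : Om -> C -> 'cV[R]_n)
    (X : Om -> C) (Y : R -> Om -> 'cV[R]_n) (Z : R -> Om -> 'M[R]_n) :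
  t1 <= s -> s <= t2 -> solution t1 t2 x h X Y Z -> H2 P W s X.
Proof.
move=> t1s st2 [aX _ _ _ _ _ _ _ bd]; split; first exact: adaptedS aX.
apply: le_lt_trans bd.
apply: (@le_trans _ _ (\int[P]_w energy s t2 X Y Z w)%E).
  apply: ge0_le_integralT => w; first by rewrite lee_fin sqr_ge0.
  by rewrite /energy EFinD -addeA leeDl// adde_ge0// lee_fin sqr_ge0.
by apply: ereal_sup_ubound; exists s => //=; rewrite in_itv/= t1s.
Qed.

Hypothesis na_b : forall t w (x x' : C) y z, 0 <= t <= T ->
  (forall s, 0 <= s <= t -> x s = x' s) -> b t w x y z = b t w x' y z.
Hypothesis na_sigma : forall t w (x x' : C) y z, 0 <= t <= T ->
  (forall s, 0 <= s <= t -> x s = x' s) -> sigma t w x y z = sigma t w x' y z.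
Hypothesis na_f : forall t w (x x' : C) y z, 0 <= t <= T ->
  (forall s, 0 <= s <= t -> x s = x' s) -> f t w x y z = f t w x' y z.
Hypothesis prog_sigma0 : progressive F 0 T
  (fun t w => sigma t w (cst_path T 0) 0 0).

(** The path X' already extends X almost surely, so only Y and Z have to be
    concatenated. On the null event where the pieces do not match, everything is
    reset to zero: Y must be continuous for every outcome, and
    sigma(X,Y,Z) must be progressive, which is known there only at a fixed
    argument of sigma. *)
Lemma solution_paste (t1 s t2 : R) (x : Om -> C) (h h' : Om -> C -> 'cV[R]_n)
    (X X' : Om -> C) (Y Y' : R -> Om -> 'cV[R]_n) (Z Z' : R -> Om -> 'M[R]_n) :
  0 <= t1 -> t1 <= s -> s < t2 -> t2 <= T ->
  solution t1 s x h X Y Z -> solution s t2 X h' X' Y' Z' ->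
  {ae P, forall w, Y' s w = Y s w} ->
  exists X'' Y'' Z'', solution t1 t2 x h' X'' Y'' Z''.
Proof.
move=> t10 t1s st2 t2T S1 S2 aeY.
have [aX aY cY pZ ix eX eY _ bd] := S1.
have [aX' aY' cY' pZ' iX' eX' eY' tX' bd'] := S2.
have s0 := le_trans t10 t1s; have st2' := ltW st2.
have [N [mN N0 subN]] := filterI iX' aeY.
have XX' w : ~ N w -> forall t, 0 <= t <= s -> X' w t = X w t.
  by move=> Nw; have [] := contrapT (contra_not (subN w) Nw).
have YY' w : ~ N w -> Y' s w = Y s w.
  by move=> Nw; have [] := contrapT (contra_not (subN w) Nw).
have aeN : {ae P, forall w, ~ N w}.
  by exists N; split => // w; exact: contrapT.
pose X'' w := if w \in N then cst_path T 0 else X' w.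
pose Y'' t w := if w \in N then 0 else if t <= s then Y t w else Y' t w.
pose Z'' t w := if w \in N then 0 else if t <= s then Z t w else Z' t w.
have X''N w : N w -> X'' w = cst_path T 0 by move=> Nw; rewrite /X'' mem_set.
have X''C w : ~ N w -> X'' w = X' w by move=> Nw; rewrite /X'' memNset.
have Y''N t w : N w -> Y'' t w = 0 by move=> Nw; rewrite /Y'' mem_set.
have Y''l t w : ~ N w -> t1 <= t <= s -> Y'' t w = Y t w.
  by move=> Nw /andP[_ ts]; rewrite /Y'' memNset// ts.
have Y''r t w : ~ N w -> s <= t <= t2 -> Y'' t w = Y' t w.
  move=> Nw /andP[st _]; rewrite /Y'' memNset//; case: ifP => // ts.
  by have -> : t = s; [apply/eqP; rewrite eq_le ts|rewrite YY'].
have Z''N t w : N w -> Z'' t w = 0 by move=> Nw; rewrite /Z'' mem_set.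
have Z''l t w : ~ N w -> t1 <= t <= s -> Z'' t w = Z t w.
  by move=> Nw /andP[_ ts]; rewrite /Z'' memNset// ts.
have Z''r t w : ~ N w -> s < t <= t2 -> Z'' t w = Z' t w.
  by move=> Nw /andP[st _]; rewrite /Z'' memNset// leNgt st.
have tT t : t1 <= t <= s -> 0 <= t <= T.
  move=> /andP[t1t ts]; rewrite (le_trans t10)//=.
  exact: le_trans ts (le_trans st2' t2T).
have past t w : ~ N w -> t1 <= t <= s -> forall r, 0 <= r <= t -> X'' w r = X w r.
  move=> Nw /andP[_ ts] r /andP[r0 rt]; rewrite X''C// XX'// r0.
  exact: le_trans rt ts.
have p0 : progressive F t1 t2 (fun _ _ => 0 : 'M[R]_n) by exact: progressive0.
have pZ'' : progressive F t1 t2 Z''.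
  apply: (progressive_paste t1s st2' mN N0 pZ pZ' p0).
  - by move=> t w Nw _; exact: Z''N.
  - exact: Z''l.
  - exact: Z''r.
exists X'', Y'', Z''; split.
- move=> t t0; rewrite (_ : (fun w => X'' w t) =
      fun w => if w \in N then 0 else X' w t); last first.
    by apply/funext => w; rewrite /X''; case: ifP.
  by apply: (measurable_wrt_if mN N0); [exact: measurable_wrt0|exact: aX'].
- move=> t /andP[t1t tt2]; apply: (measurable_wrt_if mN N0).
    exact: measurable_wrt0.
  case: (leP t s) => [ts|st]; first by apply: aY; rewrite t1t.
  by apply: aY'; rewrite (ltW st).
- move=> w; have [Nw|Nw] := pselect (N w).
    rewrite (_ : Y'' ^~ w = fun _ => 0); last by apply/funext => t; exact: Y''N.
    by move=> r; exact: cvg_cst.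
  apply: (within_continuous_paste t1s st2' (cY w) (cY' w)) => r.
    exact: Y''l.
  exact: Y''r.
- exact: pZ''.
- apply: filterS2 aeN ix => w Nw ix t t0t1; rewrite X''C// XX' ?ix//.
  by have /andP[-> /le_trans] := t0t1; apply.
- apply: (ito_equation_paste hW t10 t1s st2' mN N0 eX eX').
  + apply: (progressive_paste t1s st2' mN N0 _ _
      (progressiveS t10 t2T prog_sigma0)).
    * by have [_ [? [pH _ _ _ _] _]] := eX; exact: pH.
    * by have [_ [? [pH _ _ _ _] _]] := eX'; exact: pH.
    * by move=> t w Nw _; rewrite X''N// Y''N// Z''N.
    * move=> t w Nw t1ts; rewrite Y''l// Z''l//.
      by apply: na_sigma; [exact: tT|exact: past].
    * move=> t w Nw stt2; rewrite X''C// Z''r// Y''r//.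
      by have /andP[/ltW -> ->] := stt2.
  + move=> w Nw; split => t.
    * move=> t1ts; split; first by rewrite (past t)//; have /andP[-> _] := tT _ t1ts; rewrite /=.
      by rewrite Y''l// Z''l//; apply: na_b; [exact: tT|exact: past].
    * by move=> _; rewrite X''C.
    * move=> stt2; rewrite X''C// Z''r// Y''r//.
      by have /andP[/ltW -> ->] := stt2.
  + move=> t w Nw t1ts; rewrite Y''l// Z''l//.
    by apply: na_sigma; [exact: tT|exact: past].
  + move=> t w Nw stt2; rewrite X''C// Z''r// Y''r//.
    by have /andP[/ltW -> ->] := stt2.
- apply: (ito_equation_paste hW t10 t1s st2' mN N0 eY eY' pZ'' _ Z''l Z''r).
  move=> w Nw; split => t.
  + move=> t1ts; split; first exact: Y''l.
    by rewrite Y''l// Z''l//; congr (- _); apply: na_f; [exact: tT|exact: past].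
  + exact: Y''r.
  + move=> stt2; rewrite X''C// Z''r// Y''r//.
    by have /andP[/ltW -> ->] := stt2.
- apply: filterS2 aeN tX' => w Nw tX'.
  by rewrite Y''r// ?st2' ?lexx// X''C.
- set B1 := ereal_sup _ in bd; set B2 := ereal_sup _ in bd'.
  have B1s t : t1 <= t <= s -> (\int[P]_w energy t s X Y Z w <= B1)%E.
    by move=> t1ts; apply: ereal_sup_ubound; exists t => //=; rewrite in_itv.
  have B2s t : s <= t <= t2 -> (\int[P]_w energy t t2 X' Y' Z' w <= B2)%E.
    by move=> stt2; apply: ereal_sup_ubound; exists t => //=; rewrite in_itv.
  have B10 : (0 <= B1)%E.
    apply: le_trans (B1s s _); last by rewrite t1s lexx.
    by apply: integral_ge0 => w _; exact: energy_ge0.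
  apply: (@le_lt_trans _ _ (B1 + B2)%E); last first.
    by apply: lte_add_pinfty; [exact: bd|exact: bd'].
  apply: ge_ereal_sup => _ [t /= + <-]; rewrite in_itv/= => /andP[t1t tt2].
  have [ts|st] := leP t s; last first.
    apply: (@le_trans _ _ B2); last exact: leeDr.
    apply: le_trans (B2s t _); last by rewrite (ltW st).
    apply: (ge0_le_integral_ae (N := N)) => //.
      by move=> w _; exact: energy_ge0.
    move=> w Nw _; split => //.
    rewrite X''C// Y''r ?(ltW st)// leeD2l//; apply: time_integralS => //.
    * by move=> r; exact: sqr_ge0.
    * by move=> r; exact: sqr_ge0.
    * by move=> r /andP[tr rt2]; rewrite Z''r// (lt_trans st tr).
  have t1ts : t1 <= t <= s by rewrite t1t.
  have /andP[t0 _] := tT _ t1ts.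
  apply: (@le_trans _ _ (\int[P]_w energy t s X Y Z w +
      \int[P]_w \int[mu]_(r in `[s, t2]) (enorm (Z' r w) ^+ 2)%:E)%E); last first.
    apply: leeD; first exact: B1s.
    apply: le_trans (B2s s _); last by rewrite lexx.
    apply: ge0_le_integralT => w; first exact: tail_ge0.
    by rewrite leeDr// lee_fin addr_ge0// sqr_ge0.
  have mZ' i j := progressive_jointly_measurable i j hW s0 st2' pZ'.
  apply: (ge0_le_integralD_ae (N := N)) => //.
  * by move=> w _; exact: energy_ge0.
  * exact: measurable_time_integral.
  * move=> w Nw; rewrite !patch_setT /energy -addeA (eq_pnorm t0 (past t w Nw t1ts)).
    rewrite Y''l// leeD2l//; apply: time_integral_paste => //.
    + by move=> r; exact: sqr_ge0.
    + by move=> r; exact: sqr_ge0.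
    + by move=> r; exact: sqr_ge0.
    + exact: measurable_section.
    + by move=> r /andP[tr rs]; rewrite Z''l// (le_trans t1t).
    + by move=> r /(Z''r _ _ Nw) ->.
Qed.

End solutions.

(** * Gluing of decoupled intervals *)

Section gluing.
Context {R : realType} {disp : measure_display} {Om : measurableType disp}.
Variables (P : probability Om R) (d n : nat) (W : R -> Om -> 'cV[R]_n) (T : R).
Local Notation C := (cpath T d).
Local Notation F := (aug_filtration P W).
Variables (b : R -> Om -> C -> 'cV[R]_n -> 'M[R]_n -> 'cV[R]_d)
          (sigma : R -> Om -> C -> 'cV[R]_n -> 'M[R]_n -> 'M[R]_(d, n))
          (f : R -> Om -> C -> 'cV[R]_n -> 'M[R]_n -> 'cV[R]_n)
          (g : Om -> C -> 'cV[R]_n) (u : R -> Om -> C -> 'cV[R]_n).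

(** What a decoupling field guarantees on intervals of length at most delta,
    isolated for a single interval so that it can be propagated to longer ones. *)
Definition decoupled_on (t1 t2 : R) : Prop :=
  forall x : Om -> C, H2 P W t1 x ->
    unique_solution P W b sigma f t1 t2 x (u t2) /\
    (forall X Y Z, fbsde_solution P W b sigma f t1 t2 x (u t2) X Y Z ->
       decoupled P u t1 t2 X Y).

Hypotheses (hW : brownian_motion P W) (hA : assumption_A P W b sigma f g).
Hypothesis na_u : forall (t : R) w (x x' : C), 0 <= t <= T ->
  (forall s : R, 0 <= s <= t -> x s = x' s) -> u t w x = u t w x'.

(** A solution on [t1,t2] is first restricted to [s,t2], where decoupling gives
    Y_s = u_s(X); this is the terminal condition that makes its restriction to
    [t1,s] a solution as well. Hence decoupling and uniqueness propagate.
    Conversely the solution from t1 to s, continued from s to t2, matches at s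
    because both pieces have the value u_s(X) there. *)
Lemma decoupled_on_glue (t1 s t2 : R) : 0 <= t1 -> t1 < s -> s < t2 -> t2 <= T ->
  decoupled_on t1 s -> decoupled_on s t2 -> decoupled_on t1 t2.
Proof.
move=> t10 t1s st2 t2T D1 D2 x Hx.
have t1s' := ltW t1s; have st2' := ltW st2; have s0 := le_trans t10 t1s'.
have sT : 0 <= s <= T by rewrite s0 (le_trans st2').
have ss2 : s <= s <= t2 by rewrite lexx.
pose sol := fbsde_solution P W b sigma f.
have right X Y Z : sol t1 t2 x (u t2) X Y Z -> sol s t2 X (u t2) X Y Z.
  move=> S; apply: (solutionS hW t10 t1s' st2' (lexx t2) S).
    by apply: aeW => w t _.
  exact: sol_terminal S.
have right_decoupled X Y Z : sol t1 t2 x (u t2) X Y Z -> decoupled P u s t2 X Y.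
  move=> S; have [_] := D2 X (solution_H2 t1s' st2' S); apply; exact: right S.
have left X Y Z : sol t1 t2 x (u t2) X Y Z -> sol t1 s x (u s) X Y Z.
  move=> S; apply: (solutionS hW t10 (lexx t1) t1s' st2' S).
    exact: sol_init S.
  by apply: filterS (right_decoupled _ _ _ S) => w ->.
have [[[X [Y [Z S]]] uniq1] dec1] := D1 x Hx.
split; last first.
  move=> X' Y' Z' S'.
  apply: filterS2 (dec1 _ _ _ (left _ _ _ S')) (right_decoupled _ _ _ S').
  move=> w d1 d2 t /andP[t1t tt2]; have [ts|/ltW st] := leP t s.
    by apply: d1; rewrite t1t.
  by apply: d2; rewrite st.
split.
- have [[[X' [Y' [Z' S']]] _] dec2] := D2 X (solution_H2 t1s' (lexx s) S).
  have [Ab As Af] : [/\ progressive F 0 T (fun t w => b t w (cst_path T 0) 0 0),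
      progressive F 0 T (fun t w => sigma t w (cst_path T 0) 0 0)
    & progressive F 0 T (fun t w => f t w (cst_path T 0) 0 0)].
    exact: A_prog hA _ _ _.
  have [K0 _ [Lb Ls Lf]] := A_lip hA.
  apply: (solution_paste hW _ _ _ As t10 t1s' st2 t2T S S').
  + by move=> t w p q y z; exact: lipschitz_nonanticipative Lb.
  + by move=> t w p q y z; exact: lipschitz_nonanticipative Ls.
  + by move=> t w p q y z; exact: lipschitz_nonanticipative Lf.
  + apply: filterS3 (sol_init S') (sol_terminal S) (dec2 _ _ _ S').
    move=> w XX' Ys Y's; rewrite Y's// Ys.
    by apply: na_u => // r rs; exact: XX'.
- move=> X1 Y1 Z1 X2 Y2 Z2 S1 S2.
  have [eX eY eZ] := uniq1 _ _ _ _ _ _ (left _ _ _ S1) (left _ _ _ S2).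
  have S2' : sol s t2 X1 (u t2) X2 Y2 Z2.
    apply: (solutionS hW s0 (lexx s) st2' (lexx t2) (right _ _ _ S2)).
      by apply: filterS eX => w e t /e.
    exact: sol_terminal S2.
  have [[_ uniq2] _] := D2 X1 (solution_H2 t1s' st2' S1).
  have [eX' eY' eZ'] := uniq2 _ _ _ _ _ _ (right _ _ _ S1) S2'.
  split; first exact: eX'.
    apply: filterS2 eY eY' => w e e' t /andP[t1t tt2].
    have [ts|/ltW st] := leP t s; first by apply: e; rewrite t1t.
    by apply: e'; rewrite st.
  apply: filterS2 eZ eZ' => p e e' /andP[t1t tt2].
  have [ts|/ltW st] := leP p.1 s; first by apply: e; rewrite t1t.
  by apply: e'; rewrite st.
Qed.

(** Each application of the gluing lemma at the midpoint doubles the admissible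
    length. *)
Lemma decoupled_on_dyadic (delta : R) (k : nat) :
  (forall t1 t2, 0 <= t1 -> t1 < t2 -> t2 <= T -> t2 - t1 <= delta ->
     decoupled_on t1 t2) ->
  forall t1 t2, 0 <= t1 -> t1 < t2 -> t2 <= T -> t2 - t1 <= 2 ^+ k * delta ->
    decoupled_on t1 t2.
Proof.
move=> D; elim: k => [|k IH] t1 t2 t10 t12 t2T.
  by rewrite expr0 mul1r; exact: D.
rewrite exprS -mulrA => len; pose s := (t1 + t2) / 2.
have t1s : t1 < s by rewrite /s; lra.
have st2 : s < t2 by rewrite /s; lra.
by apply: (decoupled_on_glue t10 t1s st2 t2T); apply: IH => //; rewrite /s; lra.
Qed.

End gluing.

Lemma H2_cst_path (R : realType) (disp : measure_display)
    (Om : measurableType disp) (P : probability Om R) (d n : nat)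
    (W : R -> Om -> 'cV[R]_n) (T t : R) (x : 'cV[R]_d) :
  H2 P W t (fun _ => cst_path T x).
Proof.
split; first by move=> s _ i j; exact: measurable_cst.
rewrite integral_cst//.
by rewrite [X in (_ * X)%E](@probability_setT _ _ _ P) mule1 ltry.
Qed.

Theorem theorem3p1 (R : realType) (disp : measure_display)
  (Om : measurableType disp) (P : probability Om R) (d n : nat)
  (hd : (1 <= d)%N) (hn : (1 <= n)%N)
  (W : R -> Om -> 'cV[R]_n) (hW : brownian_motion P W)
  (T : R) (hT : 0 < T)
  (b : R -> Om -> cpath T d -> 'cV[R]_n -> 'M[R]_n -> 'cV[R]_d)
  (sigma : R -> Om -> cpath T d -> 'cV[R]_n -> 'M[R]_n -> 'M[R]_(d, n))
  (f : R -> Om -> cpath T d -> 'cV[R]_n -> 'M[R]_n -> 'cV[R]_n)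
  (g : Om -> cpath T d -> 'cV[R]_n)
  (hA : assumption_A P W b sigma f g)
  (x : 'cV[R]_d)
  (u : R -> Om -> cpath T d -> 'cV[R]_n)
  (hu : decoupling_field P W b sigma f g u) :
  unique_solution P W b sigma f 0 T (fun _ => cst_path T x) g /\
  (forall (X : Om -> cpath T d) (Y : R -> Om -> 'cV[R]_n)
     (Z : R -> Om -> 'M[R]_n),
     fbsde_solution P W b sigma f 0 T (fun _ => cst_path T x) g X Y Z ->
     decoupled P u 0 T X Y).
Proof.
have [_ uT na_u [delta delta0 D]] := hu.
have <- : u T = g by apply/funext => w; apply/funext => y; exact: uT.
suff : decoupled_on P W b sigma f u 0 T by apply; exact: H2_cst_path.
apply: (decoupled_on_dyadic (k := Num.bound (T / delta)) hW hA na_u D) => //.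
(* T <= 2 ^ k * delta because T / delta < k < 2 ^ k. *)
rewrite subr0 -ler_pdivrMr// -natrX.
apply/ltW/(lt_le_trans (archi_boundP _)); first by rewrite divr_ge0// ltW.
by rewrite ler_nat ltnW// ltn_expl.
Qed.
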